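(* Let $K$ be a field, let $n$ be a positive integer and let $0\leq j\leq n-1$. (1) If $H_j(n)>0$, then $|K_0(L_K(C_n^j))|=H_j(n)$. (2) If $H_j(n)=0$, then $K_0(L_K(C_n^j))$ is infinite.
   Context: For a directed graph $E=(E^0,E^1,r,s)$ and a field $K$, the Leavitt path algebra $L_K(E)$ is the $K$-algebra generated by $\{v\mid v\in E^0\}\cup\{e,e^*\mid e\in E^1\}$ subject to: (V) $vw=\delta_{v,w}v$ for $v,w\in E^0$; (E1) $s(e)e=er(e)=e$; (E2) $r(e)e^*=e^*s(e)=e^*$; (CK1) $e^*e'=\delta_{e,e'}r(e)$ for $e,e'\in E^1$; (CK2) $v=\sum_{\{e\in E^1\mid s(e)=v\}}ee^*$ for every $v\in E^0$ with $0<|s^{-1}(v)|<\infty$. $K_0$ denotes the Grothendieck group of a ring. $C_n^j$ is the directed graph with $n$ vertices $v_1,\dots,v_n$ and $2n$ edges $e_1,\dots,e_n,f_1,\dots,f_n$, where $e_i$ goes from $v_i$ to $v_{i+1}$ and $f_i$ goes from $v_i$ to $v_{i+j}$ (subscripts mod $n$). The incidence matrix $A_{C_n^j}$ is the $n\times n$ matrix whose $(i,k)$ entry is the number of edges from $v_i$ to $v_k$. The $j$-th Haselgrove sequence $H_j(1),H_j(2),\dots$ is given by $H_j(n)=|\det(I_n-A_{C_n^j}^t)|$. *)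

(* Defs.v *)
From HB Require Import structures.
From mathcomp Require Import all_boot all_algebra.
From mathcomp Require Import boolp classical_sets cardinality.

Set Implicit Arguments.
Unset Strict Implicit.
Unset Printing Implicit Defensive.

Import GRing.Theory.
Local Open Scope ring_scope.
Local Open Scope quotient_scope.

Record digraph (V : finType) := Digraph {
  edge : finType;
  src : edge -> V;
  tgt : edge -> V
}.

Definition incidence n (E : digraph 'I_n) : 'M[int]_n :=
  \matrix_(i, k) #|[set e : edge E | (src e == i) && (tgt e == k)]|%:Z.

(** [lpa_expr K E] is the type of formal (nonunital) [K]-algebra expressions
   in the generators [v], [e], [e^*], and [lpa_eq] is the least congruence
   containing the axioms of associative [K]-algebras and the relations (V),
   (E1), (E2), (CK1), (CK2); the quotient is the [K]-algebra presented by
   these generators and relations.  The presentation is nonunital: in a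
   unital one, [1 - \sum_v v] would be a spurious additional idempotent. *)

Section LeavittPathAlgebra.
Variables (K : fieldType) (V : finType) (E : digraph V).

Inductive lpa_expr : Type :=
  | LVertex of V
  | LEdge of edge E
  | LGhost of edge E
  | LZero
  | LOpp of lpa_expr
  | LAdd of lpa_expr & lpa_expr
  | LScale of K & lpa_expr
  | LMul of lpa_expr & lpa_expr.

Inductive lpa_eq : lpa_expr -> lpa_expr -> Prop :=
  | lpa_refl x : lpa_eq x x
  | lpa_sym x y : lpa_eq x y -> lpa_eq y x
  | lpa_trans x y z : lpa_eq x y -> lpa_eq y z -> lpa_eq x z
  | lpa_opp_cong x x' : lpa_eq x x' -> lpa_eq (LOpp x) (LOpp x')
  | lpa_add_cong x x' y y' :
      lpa_eq x x' -> lpa_eq y y' -> lpa_eq (LAdd x y) (LAdd x' y')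
  | lpa_scale_cong a x x' : lpa_eq x x' -> lpa_eq (LScale a x) (LScale a x')
  | lpa_mul_cong x x' y y' :
      lpa_eq x x' -> lpa_eq y y' -> lpa_eq (LMul x y) (LMul x' y')
  | lpa_addA x y z : lpa_eq (LAdd x (LAdd y z)) (LAdd (LAdd x y) z)
  | lpa_addC x y : lpa_eq (LAdd x y) (LAdd y x)
  | lpa_add0 x : lpa_eq (LAdd LZero x) x
  | lpa_addN x : lpa_eq (LAdd (LOpp x) x) LZero
  | lpa_scaleA a b x : lpa_eq (LScale a (LScale b x)) (LScale (a * b) x)
  | lpa_scale1 x : lpa_eq (LScale 1 x) x
  | lpa_scaleDr a x y :
      lpa_eq (LScale a (LAdd x y)) (LAdd (LScale a x) (LScale a y))
  | lpa_scaleDl a b x :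
      lpa_eq (LScale (a + b) x) (LAdd (LScale a x) (LScale b x))
  | lpa_mulA x y z : lpa_eq (LMul x (LMul y z)) (LMul (LMul x y) z)
  | lpa_mulDl x y z : lpa_eq (LMul (LAdd x y) z) (LAdd (LMul x z) (LMul y z))
  | lpa_mulDr x y z : lpa_eq (LMul x (LAdd y z)) (LAdd (LMul x y) (LMul x z))
  | lpa_scaleAl a x y : lpa_eq (LScale a (LMul x y)) (LMul (LScale a x) y)
  | lpa_scaleAr a x y : lpa_eq (LScale a (LMul x y)) (LMul x (LScale a y))
  | lpa_VV v : lpa_eq (LMul (LVertex v) (LVertex v)) (LVertex v)
  | lpa_VW v w : v != w -> lpa_eq (LMul (LVertex v) (LVertex w)) LZero
  | lpa_E1l e : lpa_eq (LMul (LVertex (src e)) (LEdge e)) (LEdge e)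
  | lpa_E1r e : lpa_eq (LMul (LEdge e) (LVertex (tgt e))) (LEdge e)
  | lpa_E2l e : lpa_eq (LMul (LVertex (tgt e)) (LGhost e)) (LGhost e)
  | lpa_E2r e : lpa_eq (LMul (LGhost e) (LVertex (src e))) (LGhost e)
  | lpa_CK1 e : lpa_eq (LMul (LGhost e) (LEdge e)) (LVertex (tgt e))
  | lpa_CK1' e f : e != f -> lpa_eq (LMul (LGhost e) (LEdge f)) LZero
  (* [v] emits finitely many edges, [edge E] being finite. *)
  | lpa_CK2 v : (0 < #|[set e : edge E | src e == v]|)%N ->
      lpa_eq (LVertex v)
             (\big[LAdd/LZero]_(e : edge E | src e == v)
                 LMul (LEdge e) (LGhost e)).

HB.instance Definition _ := gen_eqMixin lpa_expr.
HB.instance Definition _ := gen_choiceMixin lpa_expr.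

Definition lpa_eqb (x y : lpa_expr) : bool := `[< lpa_eq x y >].

Lemma lpa_eqb_refl : reflexive lpa_eqb.
Proof. by move=> x; apply/asboolP/lpa_refl. Qed.

Lemma lpa_eqb_sym : symmetric lpa_eqb.
Proof.
by move=> x y; apply/idP/idP => /asboolP h; apply/asboolP/lpa_sym.
Qed.

Lemma lpa_eqb_trans : transitive lpa_eqb.
Proof.
by move=> y x z /asboolP h /asboolP h'; apply/asboolP/(lpa_trans h h').
Qed.

Canonical lpa_equiv := EquivRel lpa_eqb lpa_eqb_refl lpa_eqb_sym lpa_eqb_trans.

Definition LPA : Type := {eq_quot lpa_equiv}.

HB.instance Definition _ : EqQuotient _ lpa_equiv LPA :=
  EqQuotient.on LPA.
HB.instance Definition _ := Choice.on LPA.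

Definition lpa_cl (x : lpa_expr) : LPA := \pi_LPA x.

Lemma lpa_clP x y : lpa_cl x = lpa_cl y <-> lpa_eq x y.
Proof.
split=> [/eqP|h]; last by apply/eqP; rewrite eqmodE; apply/asboolP.
by rewrite eqmodE => /asboolP.
Qed.

Lemma lpa_clE x y : lpa_eq x y -> lpa_cl x = lpa_cl y.
Proof. by move/lpa_clP. Qed.

Lemma lpa_clK (x : LPA) : lpa_cl (repr x) = x.
Proof. exact: reprK. Qed.

Lemma lpa_repr x : lpa_eq (repr (lpa_cl x)) x.
Proof. by apply/lpa_clP; rewrite lpa_clK. Qed.

Lemma lpa_ind (P : LPA -> Prop) : (forall x, P (lpa_cl x)) -> forall x, P x.
Proof. by move=> h x; rewrite -(lpa_clK x). Qed.

Definition lpa_opp (x : LPA) : LPA := lpa_cl (LOpp (repr x)).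
Definition lpa_add (x y : LPA) : LPA := lpa_cl (LAdd (repr x) (repr y)).
Definition lpa_scale (a : K) (x : LPA) : LPA := lpa_cl (LScale a (repr x)).
Definition lpa_mul (x y : LPA) : LPA := lpa_cl (LMul (repr x) (repr y)).

Lemma lpa_oppE x : lpa_opp (lpa_cl x) = lpa_cl (LOpp x).
Proof. exact/lpa_clE/lpa_opp_cong/lpa_repr. Qed.

Lemma lpa_addE x y : lpa_add (lpa_cl x) (lpa_cl y) = lpa_cl (LAdd x y).
Proof. by apply/lpa_clE/lpa_add_cong; apply: lpa_repr. Qed.

Lemma lpa_scaleE a x : lpa_scale a (lpa_cl x) = lpa_cl (LScale a x).
Proof. exact/lpa_clE/lpa_scale_cong/lpa_repr. Qed.

Lemma lpa_mulE x y : lpa_mul (lpa_cl x) (lpa_cl y) = lpa_cl (LMul x y).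
Proof. by apply/lpa_clE/lpa_mul_cong; apply: lpa_repr. Qed.

Let lpaE := (lpa_oppE, lpa_addE, lpa_scaleE, lpa_mulE).

Fact lpa_addrA : associative lpa_add.
Proof.
elim/lpa_ind=> x; elim/lpa_ind=> y; elim/lpa_ind=> z.
by rewrite !lpaE; apply/lpa_clE/lpa_addA.
Qed.

Fact lpa_addrC : commutative lpa_add.
Proof.
elim/lpa_ind=> x; elim/lpa_ind=> y; rewrite !lpaE; exact/lpa_clE/lpa_addC.
Qed.

Fact lpa_add0r : left_id (lpa_cl LZero) lpa_add.
Proof. by elim/lpa_ind=> x; rewrite !lpaE; apply/lpa_clE/lpa_add0. Qed.

Fact lpa_addNr : left_inverse (lpa_cl LZero) lpa_opp lpa_add.
Proof. by elim/lpa_ind=> x; rewrite !lpaE; apply/lpa_clE/lpa_addN. Qed.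

HB.instance Definition _ :=
  GRing.isZmodule.Build LPA lpa_addrA lpa_addrC lpa_add0r lpa_addNr.

Fact lpa_scalerA a b x : lpa_scale a (lpa_scale b x) = lpa_scale (a * b) x.
Proof. by elim/lpa_ind: x => x; rewrite !lpaE; apply/lpa_clE/lpa_scaleA. Qed.

Fact lpa_scale1r : left_id 1 lpa_scale.
Proof. by elim/lpa_ind=> x; rewrite !lpaE; apply/lpa_clE/lpa_scale1. Qed.

Fact lpa_scalerDr : right_distributive lpa_scale +%R.
Proof.
move=> a; elim/lpa_ind=> x; elim/lpa_ind=> y.
by rewrite /GRing.add /= !lpaE; apply/lpa_clE/lpa_scaleDr.
Qed.

Fact lpa_scalerDl x : {morph lpa_scale^~ x : a b / a + b}.
Proof.
move=> a b; elim/lpa_ind: x => x.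
by rewrite [RHS]/GRing.add /= !lpaE; apply/lpa_clE/lpa_scaleDl.
Qed.

HB.instance Definition _ := GRing.Zmodule_isLmodule.Build K LPA
  lpa_scalerA lpa_scale1r lpa_scalerDr lpa_scalerDl.

Fact lpa_mulrA : associative lpa_mul.
Proof.
elim/lpa_ind=> x; elim/lpa_ind=> y; elim/lpa_ind=> z.
by rewrite !lpaE; apply/lpa_clE/lpa_mulA.
Qed.

Fact lpa_mulrDl : left_distributive lpa_mul +%R.
Proof.
elim/lpa_ind=> x; elim/lpa_ind=> y; elim/lpa_ind=> z.
by rewrite /GRing.add /= !lpaE; apply/lpa_clE/lpa_mulDl.
Qed.

Fact lpa_mulrDr : right_distributive lpa_mul +%R.
Proof.
elim/lpa_ind=> x; elim/lpa_ind=> y; elim/lpa_ind=> z.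
by rewrite /GRing.add /= !lpaE; apply/lpa_clE/lpa_mulDr.
Qed.

Fact lpa_mulscaleAl a (x y : LPA) : a *: lpa_mul x y = lpa_mul (a *: x) y.
Proof.
elim/lpa_ind: x => x; elim/lpa_ind: y => y.
by rewrite /GRing.scale /= !lpaE; apply/lpa_clE/lpa_scaleAl.
Qed.

Fact lpa_mulscaleAr a (x y : LPA) : a *: lpa_mul x y = lpa_mul x (a *: y).
Proof.
elim/lpa_ind: x => x; elim/lpa_ind: y => y.
by rewrite /GRing.scale /= !lpaE; apply/lpa_clE/lpa_scaleAr.
Qed.

Definition lpa_vertex (v : V) : LPA := lpa_cl (LVertex v).
Definition lpa_edge (e : edge E) : LPA := lpa_cl (LEdge e).
Definition lpa_ghost (e : edge E) : LPA := lpa_cl (LGhost e).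

(* The graph being finite, the algebra has a unit. *)
Definition lpa_one : LPA := \sum_(v : V) lpa_vertex v.

Fact lpa_mulr0 x : lpa_mul x 0 = 0.
Proof. by apply: (addIr (lpa_mul x 0)); rewrite -lpa_mulrDr !add0r. Qed.

Fact lpa_mul0r x : lpa_mul 0 x = 0.
Proof. by apply: (addIr (lpa_mul 0 x)); rewrite -lpa_mulrDl !add0r. Qed.

Fact lpa_mul_suml (I : finType) (F : I -> LPA) x :
  lpa_mul (\sum_i F i) x = \sum_i lpa_mul (F i) x.
Proof.
by apply: (big_morph (lpa_mul^~ x)) => [y z|]; rewrite ?lpa_mulrDl ?lpa_mul0r.
Qed.

Fact lpa_mul_sumr (I : finType) (F : I -> LPA) x :
  lpa_mul x (\sum_i F i) = \sum_i lpa_mul x (F i).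
Proof.
by apply: (big_morph (lpa_mul x)) => [y z|]; rewrite ?lpa_mulrDr ?lpa_mulr0.
Qed.

Fact lpa_mul1_vertex v : lpa_mul lpa_one (lpa_vertex v) = lpa_vertex v.
Proof.
rewrite lpa_mul_suml (bigD1 v) //= big1 ?addr0 => [|w wv].
  by rewrite lpaE; apply/lpa_clE/lpa_VV.
by rewrite lpaE; apply/lpa_clE/lpa_VW.
Qed.

Fact lpa_mul_vertex1 v : lpa_mul (lpa_vertex v) lpa_one = lpa_vertex v.
Proof.
rewrite lpa_mul_sumr (bigD1 v) //= big1 ?addr0 => [|w wv].
  by rewrite lpaE; apply/lpa_clE/lpa_VV.
by rewrite lpaE; apply/lpa_clE/lpa_VW; rewrite eq_sym.
Qed.

Fact lpa_mul1r : left_id lpa_one lpa_mul.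
Proof.
elim/lpa_ind; elim=> [v|e|e||x IHx|x IHx y IHy|a x IHx|x IHx y IHy].
- exact: lpa_mul1_vertex.
- rewrite -(lpa_clE (lpa_E1l e)) -lpa_mulE lpa_mulrA.
  by rewrite (lpa_mul1_vertex (src e)).
- rewrite -(lpa_clE (lpa_E2l e)) -lpa_mulE lpa_mulrA.
  by rewrite (lpa_mul1_vertex (tgt e)).
- exact: lpa_mulr0.
- rewrite -lpa_oppE -[lpa_opp _]/(- lpa_cl x).
  by apply: (addIr (lpa_cl x)); rewrite addNr -{2}IHx -lpa_mulrDr addNr lpa_mulr0.
- by rewrite -lpa_addE lpa_mulrDr IHx IHy.
- by rewrite -lpa_scaleE -lpa_mulscaleAr IHx.
- by rewrite -lpa_mulE lpa_mulrA IHx.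
Qed.

Fact lpa_mulr1 : right_id lpa_one lpa_mul.
Proof.
elim/lpa_ind; elim=> [v|e|e||x IHx|x IHx y IHy|a x IHx|x IHx y IHy].
- exact: lpa_mul_vertex1.
- rewrite -(lpa_clE (lpa_E1r e)) -lpa_mulE -lpa_mulrA.
  by rewrite (lpa_mul_vertex1 (tgt e)).
- rewrite -(lpa_clE (lpa_E2r e)) -lpa_mulE -lpa_mulrA.
  by rewrite (lpa_mul_vertex1 (src e)).
- exact: lpa_mul0r.
- rewrite -lpa_oppE -[lpa_opp _]/(- lpa_cl x).
  by apply: (addIr (lpa_cl x)); rewrite addNr -{2}IHx -lpa_mulrDl addNr lpa_mul0r.
- by rewrite -lpa_addE lpa_mulrDl IHx IHy.
- by rewrite -lpa_scaleE -lpa_mulscaleAl IHx.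
- by rewrite -lpa_mulE -lpa_mulrA IHy.
Qed.

HB.instance Definition _ := GRing.Zmodule_isPzRing.Build LPA
  lpa_mulrA lpa_mul1r lpa_mulr1 lpa_mulrDl lpa_mulrDr.

(* MathComp's [algType K] requires [1 != 0]. *)
Lemma lpa_scalerAl a (x y : LPA) : a *: (x * y) = (a *: x) * y.
Proof. exact: lpa_mulscaleAl. Qed.

Lemma lpa_scalerAr a (x y : LPA) : a *: (x * y) = x * (a *: y).
Proof. exact: lpa_mulscaleAr. Qed.

End LeavittPathAlgebra.

Section Grothendieck.
Variable M : nmodType.

Definition groth_rel (x y : M * M) : bool :=
  `[< exists k : M, x.1 + y.2 + k = y.1 + x.2 + k >].

Lemma groth_rel_refl : reflexive groth_rel.
Proof. by move=> x; apply/asboolP; exists 0. Qed.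

Lemma groth_rel_sym : symmetric groth_rel.
Proof.
by move=> x y; apply/idP/idP => /asboolP[k hk]; apply/asboolP; exists k.
Qed.

Lemma groth_rel_trans : transitive groth_rel.
Proof.
move=> y x z /asboolP[k hk] /asboolP[l hl]; apply/asboolP.
exists (y.1 + y.2 + k + l).
have -> : x.1 + z.2 + (y.1 + y.2 + k + l)
        = (x.1 + y.2 + k) + (y.1 + z.2 + l).
  by rewrite !addrA [LHS](ACl (1*4*5*3*2*6)).
rewrite hk hl.
by rewrite !addrA [LHS](ACl (4*2*1*5*3*6)).
Qed.

Canonical groth_equiv :=
  EquivRel groth_rel groth_rel_refl groth_rel_sym groth_rel_trans.

Definition groth : Type := {eq_quot groth_equiv}.

HB.instance Definition _ : EqQuotient _ groth_equiv groth :=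
  EqQuotient.on groth.
HB.instance Definition _ := Choice.on groth.

Definition groth_cl (x : M * M) : groth := \pi_groth x.

Lemma groth_clP (x y : M * M) : groth_cl x = groth_cl y <->
  exists k : M, x.1 + y.2 + k = y.1 + x.2 + k.
Proof.
split=> [/eqP|h]; last by apply/eqP; rewrite eqmodE; apply/asboolP.
by rewrite eqmodE => /asboolP.
Qed.

Lemma groth_clK x : groth_cl (repr x) = x.
Proof. exact: reprK. Qed.

Lemma groth_ind (P : groth -> Prop) :
  (forall x y, P (groth_cl (x, y))) -> forall x, P x.
Proof. by move=> h x; rewrite -(groth_clK x); case: (repr x). Qed.

Definition groth_opp (x : groth) : groth := groth_cl ((repr x).2, (repr x).1).
Definition groth_add (x y : groth) : groth := groth_cl (repr x + repr y).

Lemma groth_oppE a b : groth_opp (groth_cl (a, b)) = groth_cl (b, a).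
Proof.
apply/groth_clP.
have /groth_clP[k hk] := groth_clK (groth_cl (a, b)).
by exists k; rewrite /= in hk *; rewrite [_ + a]addrC [b + _]addrC hk.
Qed.

Lemma groth_addE x y : groth_add (groth_cl x) (groth_cl y) = groth_cl (x + y).
Proof.
apply/groth_clP.
have /groth_clP[k hk] := groth_clK (groth_cl x).
have /groth_clP[l hl] := groth_clK (groth_cl y).
exists (k + l); rewrite /=.
set r := repr _ in hk *; set s := repr _ in hl *.
transitivity ((r.1 + x.2 + k) + (s.1 + y.2 + l)).
  by rewrite !addrA [RHS](ACl (1*4*2*5*3*6)).
by rewrite hk hl !addrA [LHS](ACl (1*4*2*5*3*6)).
Qed.

Fact groth_addA : associative groth_add.
Proof.
elim/groth_ind=> a a'; elim/groth_ind=> b b'; elim/groth_ind=> c c'.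
by rewrite !groth_addE addrA.
Qed.

Fact groth_addC : commutative groth_add.
Proof.
elim/groth_ind=> a a'; elim/groth_ind=> b b'.
by rewrite !groth_addE addrC.
Qed.

Fact groth_add0 : left_id (groth_cl 0) groth_add.
Proof. by elim/groth_ind=> a a'; rewrite groth_addE add0r. Qed.

Fact groth_addN : left_inverse (groth_cl 0) groth_opp groth_add.
Proof.
elim/groth_ind=> a b; rewrite groth_oppE groth_addE; apply/groth_clP.
by exists 0; rewrite /= !addr0 add0r addrC.
Qed.

HB.instance Definition _ :=
  GRing.isZmodule.Build groth groth_addA groth_addC groth_add0 groth_addN.

End Grothendieck.

(** [K0 R] is the Grothendieck group of the monoid [Vmon R] of isomorphism
   classes of finitely generated projective left [R]-modules under direct sum.
   These modules form a proper class, so they are represented by the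
   modules [idem_mod e = {x in R^n | x e = x}], for [e] an idempotent [n x n]
   matrix; [idem_mod_fgproj] and [fgproj_idem_mod] show that these are, up to
   isomorphism, exactly the finitely generated projective modules, and
   [idem_mod_dsum] that the addition of [Vmon R] is the direct sum. *)

Section ProjectiveModules.
Variable R : pzRingType.
Implicit Types P Q S : lmodType R.

Definition fin_gen P : Prop :=
  exists n (g : 'I_n -> P), forall p, exists a : 'I_n -> R,
    p = \sum_i a i *: g i.

Definition projective P : Prop :=
  forall (M N : lmodType R) (g : {linear M -> N}) (h : {linear P -> N}),
    (forall y, exists x, g x = y) ->
    exists k : {linear P -> M}, forall p, g (k p) = h p.

Definition lmod_iso P Q : Prop := exists f : {linear P -> Q}, bijective f.

Lemma linear_build P Q (f : P -> Q) : linear f ->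
  exists g : {linear P -> Q}, forall x, g x = f x.
Proof.
move=> lf; pose m := GRing.isLinear.Build R P Q _ f lf.
by exists (HB.pack_for {linear P -> Q} f m).
Qed.

Lemma lmod_iso_build P Q (f : P -> Q) : linear f -> bijective f -> lmod_iso P Q.
Proof.
move=> /linear_build[g gE] bf; exists g; apply: (eq_bij bf) => x.
by rewrite gE.
Qed.

Lemma lmod_iso_refl P : lmod_iso P P.
Proof. by apply: (@lmod_iso_build _ _ id) => //; exists id. Qed.

Lemma lmod_iso_sym P Q : lmod_iso P Q -> lmod_iso Q P.
Proof.
move=> [f [g fK gK]]; apply: (@lmod_iso_build _ _ g); last by exists f.
by move=> a x y; apply: (can_inj fK); rewrite gK linearP !gK.
Qed.

Lemma lmod_iso_trans P Q S : lmod_iso P Q -> lmod_iso Q S -> lmod_iso P S.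
Proof. by move=> [f bf] [g bg]; exists (g \o f); apply: bij_comp. Qed.

Lemma lmod_iso_prod P P' Q Q' :
  lmod_iso P P' -> lmod_iso Q Q' -> lmod_iso (P * Q)%type (P' * Q')%type.
Proof.
move=> [f [f' fK f'K]] [g [g' gK g'K]].
apply: (@lmod_iso_build _ _ (fun x => (f x.1, g x.2))).
  by move=> a x y /=; rewrite !linearP.
exists (fun x => (f' x.1, g' x.2)) => -[x y] /=; first by rewrite fK gK.
by rewrite f'K g'K.
Qed.

Lemma lmod_iso_prodC P Q : lmod_iso (P * Q)%type (Q * P)%type.
Proof.
apply: (@lmod_iso_build _ _ (fun x => (x.2, x.1))); first by [].
by exists (fun x => (x.2, x.1)) => -[].
Qed.

Lemma lmod_iso_prodA P Q S :
  lmod_iso (P * (Q * S))%type (P * Q * S)%type.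
Proof.
apply: (@lmod_iso_build _ _ (fun x => (x.1, x.2.1, x.2.2))); first by [].
by exists (fun x => (x.1.1, (x.1.2, x.2))); [move=> [? []]|move=> [[]]].
Qed.

Record idem : Type := Idem {
  idem_size : nat;
  idem_mx : 'M[R]_idem_size;
  idem_mxP : idem_mx *m idem_mx = idem_mx
}.

HB.instance Definition _ := gen_eqMixin idem.
HB.instance Definition _ := gen_choiceMixin idem.

Section IdemMod.
Variable e : idem.

Definition idem_fix : {pred 'rV[R]_(idem_size e)} :=
  fun x => x *m idem_mx e == x.

Record idem_mod : Type := IdemMod {
  idem_val : 'rV[R]_(idem_size e);
  _ : idem_val \in idem_fix
}.

HB.instance Definition _ := [isSub for idem_val].
HB.instance Definition _ := [Choice of idem_mod by <:].

Fact idem_fix_closed : GRing.subsemimod_closed idem_fix.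
Proof.
split; first split.
- by rewrite unfold_in mul0mx.
- by move=> x y /eqP hx /eqP hy; rewrite unfold_in mulmxDl hx hy.
- by move=> a x /eqP hx; rewrite unfold_in -scalemxAl hx.
Qed.

HB.instance Definition _ :=
  GRing.SubChoice_isSubLmodule.Build R _ idem_fix idem_mod idem_fix_closed.

Lemma idem_valK (x : idem_mod) : idem_val x *m idem_mx e = idem_val x.
Proof. by case: x => x /= /eqP. Qed.

Lemma idem_proj_subproof (x : 'rV_(idem_size e)) : x *m idem_mx e \in idem_fix.
Proof. by rewrite unfold_in -mulmxA idem_mxP. Qed.

Definition idem_proj (x : 'rV_(idem_size e)) : idem_mod :=
  IdemMod (idem_proj_subproof x).

Lemma idem_valD (x y : idem_mod) :
  idem_val (x + y) = idem_val x + idem_val y.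
Proof. exact: (raddfD val). Qed.

Lemma idem_valZ a (x : idem_mod) : idem_val (a *: x) = a *: idem_val x.
Proof. by []. Qed.

Lemma idem_proj_linear : linear idem_proj.
Proof.
move=> a x y; apply: val_inj.
rewrite [RHS](idem_valD (a *: idem_proj x)) -[LHS]/((a *: x + y) *m idem_mx e) mulmxDl.
by rewrite -scalemxAl.
Qed.

Lemma idem_projK (x : idem_mod) : idem_proj (idem_val x) = x.
Proof. by apply: val_inj; rewrite /= idem_valK. Qed.

End IdemMod.

Arguments idem_fix : clear implicits.

Lemma idem_mod_fgproj (e : idem) :
  fin_gen (idem_mod e) /\ projective (idem_mod e).
Proof.
have [pr prE] := linear_build (@idem_proj_linear e).
have gen (x : idem_mod e) :
    x = \sum_i idem_val x 0 i *: pr (delta_mx 0 i).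
  rewrite -[LHS]idem_projK -prE {1}[idem_val x]row_sum_delta linear_sum /=.
  by apply: eq_bigr => i _; rewrite linearZ.
split; first by exists (idem_size e), (fun i => pr (delta_mx 0 i)) => x;
  exists (idem_val x 0); exact: gen.
move=> M N g h gsurj.
have [x xE] := choice (fun i => gsurj (h (pr (delta_mx 0 i)))).
have [k kE] : exists k : {linear idem_mod e -> M},
    forall p, k p = \sum_i idem_val p 0 i *: x i.
  apply: linear_build => a y z; rewrite scaler_sumr -big_split.
  apply: eq_bigr => i _.
  by rewrite idem_valD idem_valZ !mxE scalerDl scalerA.
exists k => p; rewrite kE linear_sum [in RHS](gen p) linear_sum /=.
by apply: eq_bigr => i _; rewrite !linearZ /= xE.
Qed.

Lemma fgproj_idem_mod P :
  fin_gen P -> projective P -> exists e : idem, lmod_iso P (idem_mod e).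
Proof.
move=> [n [g gP]] projP.
have [q qE] : exists q : {linear 'rV[R]_n -> P},
    forall x, q x = \sum_i x 0 i *: g i.
  apply: linear_build => a y z; rewrite scaler_sumr -big_split /=.
  by apply: eq_bigr => i _; rewrite !mxE scalerDl scalerA.
have qsurj y : exists x, q x = y.
  have [a ->] := gP y; exists (\row_i a i); rewrite qE.
  by apply: eq_bigr => i _; rewrite mxE.
have [k kP] := projP _ _ q (idfun : {linear P -> P}) qsurj.
pose E := lin1_mx (k \o q).
have EE x : x *m E = k (q x) by rewrite mul_rV_lin1.
have EK : E *m E = E.
  by apply/row_matrixP => i; rewrite row_mul EE !rowE EE kP.
exists (Idem EK).
have kfix p : k p \in idem_fix (Idem EK) by rewrite unfold_in /= EE kP.
apply: (@lmod_iso_build _ _ (fun p => IdemMod (kfix p) : idem_mod (Idem EK))).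
  move=> a x y; apply: val_inj.
  by rewrite [RHS](idem_valD (a *: (IdemMod (kfix x) : idem_mod _))) /= linearP.
exists (fun x : idem_mod (Idem EK) => q (idem_val x)) => [p|x] /=.
  exact: kP.
apply: val_inj => /=; rewrite -EE; exact: (idem_valK x).
Qed.

Fact idem_dsum_subproof (e f : idem) :
  let m := block_mx (idem_mx e) 0 0 (idem_mx f) in m *m m = m.
Proof.
by rewrite /= mulmx_block !idem_mxP !mulmx0 !mul0mx !addr0 !add0r.
Qed.

Definition idem_dsum (e f : idem) : idem := Idem (idem_dsum_subproof e f).

Definition idem0 : idem := @Idem 0 0 (mul0mx _ _).

Lemma idem_mod_dsum (e f : idem) :
  lmod_iso (idem_mod (idem_dsum e f)) (idem_mod e * idem_mod f)%type.
Proof.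
apply: lmod_iso_sym.
have fixP (x : idem_mod e * idem_mod f) :
    row_mx (idem_val x.1) (idem_val x.2) \in idem_fix (idem_dsum e f).
  rewrite unfold_in /= mul_row_block !mulmx0 addr0 add0r.
  by rewrite !idem_valK.
apply: (@lmod_iso_build _ _
  (fun x => IdemMod (fixP x) : idem_mod (idem_dsum e f))).
  move=> a x y; apply: val_inj.
  rewrite [RHS](idem_valD (a *: (IdemMod (fixP x) : idem_mod _))).
  rewrite -[LHS]/(row_mx (idem_val (a *: x.1 + y.1))
                         (idem_val (a *: x.2 + y.2))).
  by rewrite !idem_valD !idem_valZ -add_row_mx -scale_row_mx.
exists (fun z : idem_mod (idem_dsum e f) =>
  (idem_proj (e := e) (lsubmx (idem_val z)),
   idem_proj (e := f) (rsubmx (idem_val z)))) => [[x y]|z].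
  by rewrite /= row_mxKl row_mxKr !idem_projK.
apply: val_inj => /=; rewrite -[RHS](idem_valK z) -[in RHS](hsubmxK (idem_val z)).
by rewrite mul_row_block !mulmx0 addr0 add0r.
Qed.

Lemma idem_mod0 P : lmod_iso (idem_mod idem0 * P)%type P.
Proof.
apply: (@lmod_iso_build _ _ snd); first by [].
exists (fun p => (0, p)) => [[x p]|p] //=.
by congr (_, _); apply: val_inj; apply/rowP => -[].
Qed.

Definition idem_iso (e f : idem) : bool :=
  `[< lmod_iso (idem_mod e) (idem_mod f) >].

Lemma idem_iso_refl : reflexive idem_iso.
Proof. by move=> e; apply/asboolP/lmod_iso_refl. Qed.

Lemma idem_iso_sym : symmetric idem_iso.
Proof.
by move=> e f; apply/idP/idP => /asboolP h; apply/asboolP/lmod_iso_sym.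
Qed.

Lemma idem_iso_trans : transitive idem_iso.
Proof.
by move=> f e g /asboolP h /asboolP h'; apply/asboolP/(lmod_iso_trans h h').
Qed.

Canonical idem_equiv :=
  EquivRel idem_iso idem_iso_refl idem_iso_sym idem_iso_trans.

Definition Vmon : Type := {eq_quot idem_equiv}.

HB.instance Definition _ : EqQuotient _ idem_equiv Vmon :=
  EqQuotient.on Vmon.
HB.instance Definition _ := Choice.on Vmon.

Definition Vcl (e : idem) : Vmon := \pi_Vmon e.

Lemma VclP e f : Vcl e = Vcl f <-> lmod_iso (idem_mod e) (idem_mod f).
Proof.
split=> [/eqP|h]; last by apply/eqP; rewrite eqmodE; apply/asboolP.
by rewrite eqmodE => /asboolP.
Qed.

Lemma VclK x : Vcl (repr x) = x.
Proof. exact: reprK. Qed.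

Lemma Vmon_ind (P : Vmon -> Prop) : (forall e, P (Vcl e)) -> forall x, P x.
Proof. by move=> h x; rewrite -(VclK x). Qed.

Definition Vadd (x y : Vmon) : Vmon := Vcl (idem_dsum (repr x) (repr y)).

Lemma VaddE e f : Vadd (Vcl e) (Vcl f) = Vcl (idem_dsum e f).
Proof.
apply/VclP; apply: lmod_iso_trans (idem_mod_dsum _ _) _.
apply: lmod_iso_trans (lmod_iso_sym (idem_mod_dsum _ _)).
by apply: lmod_iso_prod; apply/VclP; rewrite VclK.
Qed.

Fact VaddA : associative Vadd.
Proof.
elim/Vmon_ind=> e; elim/Vmon_ind=> f; elim/Vmon_ind=> g.
rewrite !VaddE; apply/VclP.
apply: lmod_iso_trans (idem_mod_dsum _ _) _.
apply: lmod_iso_trans (lmod_iso_sym (idem_mod_dsum _ _)).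
apply: lmod_iso_trans
  (lmod_iso_prod (lmod_iso_refl _) (idem_mod_dsum _ _)) _.
apply: lmod_iso_trans
  (lmod_iso_prod (lmod_iso_sym (idem_mod_dsum _ _)) (lmod_iso_refl _)).
exact: lmod_iso_prodA.
Qed.

Fact VaddC : commutative Vadd.
Proof.
elim/Vmon_ind=> e; elim/Vmon_ind=> f; rewrite !VaddE; apply/VclP.
apply: lmod_iso_trans (idem_mod_dsum _ _) _.
apply: lmod_iso_trans (lmod_iso_sym (idem_mod_dsum _ _)).
exact: lmod_iso_prodC.
Qed.

Fact Vadd0 : left_id (Vcl idem0) Vadd.
Proof.
elim/Vmon_ind=> e; rewrite VaddE; apply/VclP.
exact: lmod_iso_trans (idem_mod_dsum _ _) (idem_mod0 _).
Qed.

HB.instance Definition _ := GRing.isNmodule.Build Vmon VaddA VaddC Vadd0.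

Definition K0 : zmodType := groth Vmon.

End ProjectiveModules.

(* Vertices are indexed by [0, ..., n-1]; [inl i] is the edge [e_i] and
   [inr i] is the edge [f_i]. *)
Definition ord_shift n (i : 'I_n) (j : nat) : 'I_n :=
  Ordinal (ltn_pmod (i + j) (leq_ltn_trans (leq0n i) (ltn_ord i))).

Definition Cgraph (n j : nat) : digraph 'I_n := {|
  edge := ('I_n + 'I_n)%type;
  src := fun x => match x with inl i => i | inr i => i end;
  tgt := fun x => match x with
                  | inl i => ord_shift i 1
                  | inr i => ord_shift i j
                  end
|}.

Definition haselgrove (j n : nat) : nat :=
  `|\det (1%:M - (incidence (Cgraph n j))^T)|%N.

(* Main.v *)
Require Import Defs.
From HB Require Import structures.
From mathcomp Require Import all_boot all_algebra.
From mathcomp Require Import boolp classical_sets cardinality.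
From mathcomp Require Import zify.

Set Implicit Arguments.
Unset Strict Implicit.
Unset Printing Implicit Defensive.

Import GRing.Theory.
Local Open Scope ring_scope.

(** Let [L] be the Leavitt path algebra of a finite graph without sinks, with
   incidence matrix [A], and let [Z^V] be the free abelian group on the vertices.
   The classes of the projective modules [L v] satisfy
   [[L v] = \sum_(s(e) = v) [L r(e)]], because by (CK1) and (CK2) the edges and
   ghost edges at [v] are inverse isomorphisms.  The point is that these classes
   generate [K_0(L)] and that there are no other relations, so that [K_0(L)] is
   the cokernel of [1 - A]: [Z^V -> Z^V].  By the Smith normal form this cokernel
   has [|det (1 - A)|] elements if this is nonzero and is infinite otherwise.

   Both facts come from comparing [L] with its subalgebra of ghost polynomials,
   spanned by the vertices and the ghost paths.  This is a path algebra: its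
   ghost paths are linearly independent ([gpoly_unique]), as one sees by letting
   [L] act on functions of infinite paths.  By (CK2) every element of [L], or of
   an [L]-module generated by a set [Q] stable under ghosts, falls into the ghost
   polynomials, or into [Q], after multiplication by all ghost paths of some
   length, and it can be recovered from these products
   ([eventually_submodule], [after_submodule]).

   Generation ([vertex_resolution]).  Let [P] be the module of the rows fixed by
   an idempotent matrix, and let [P_k] be the finite-dimensional space of the
   rows of [P] whose entries are ghost polynomials of length less than [k].  For
   large [d] the space [P_{d+1}] generates [P].  Choose a basis [u] of [P_d]
   and extend it to a basis [w] of [P_{d+1}], both made of vectors fixed by
   vertices.  As [e^* u_i] lies in [P_{d+1}], the identities
   [u_i = \sum_e e (e^* u_i)] are relations between the generators [w].  Looking
   at leading terms, one finds that they generate all relations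
   ([kernel_relspace]) and are independent ([relmx_inj]).  Hence the class of [P]
   is the difference of the classes of two sums of modules [L v].

   Relations ([vcount_index]).  An isomorphism between the sums of the [L (t i)]
   and of the [L (t' j)] carries the lattice [Q] of ghost polynomial rows of the
   first to a lattice commensurable with the lattice [Q'] of the second: their
   intersection [I] has finite codimension in both, since finitely many
   generators have bounded denominators.  Let [d v] be the codimension of [v I]
   in [v Q].  The part of [Q] at [w] is the direct sum of the lines of the
   generators at [w] and of the [e^* s(e) Q] for the edges [e] ending at [w], so
   that
   [dim (w Q / \sum_(r(e) = w) e^* I) = #{i | t i = w} + \sum_(r(e) = w) d s(e)],
   while the same dimension is [d w + dim (w I / \sum_(r(e) = w) e^* I)].  The last
   term only depends on [I].  Subtracting the corresponding equations for [Q']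
   shows that the difference of the two multiplicity vectors is in the image of
   [1 - A]. *)

(** * Relative dimension of subspaces *)

(** A module over a ring is seen as a vector space over a field mapped to this
   ring, without any change of structure on the module. *)
Section RelativeDimension.
Variables (K : fieldType) (R : pzRingType) (iota : {rmorphism K -> R}).

Definition comb (M : lmodType R) (I : finType) (c : I -> K) (x : I -> M) : M :=
  \sum_i iota (c i) *: x i.

Definition kspace (M : lmodType R) (W : M -> Prop) : Prop :=
  W 0 /\ forall c x y, W x -> W y -> W (iota c *: x + y).

Definition indep_mod (M : lmodType R) (W : M -> Prop) (I : finType) (x : I -> M) :=
  forall c, W (comb c x) -> forall i, c i = 0.

Definition spans_mod (M : lmodType R) (W : M -> Prop) (I : finType) (x : I -> M)
    (U : M -> Prop) :=
  forall u, U u -> exists c, W (u - comb c x).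

Definition basis_mod (M : lmodType R) (W : M -> Prop) (I : finType) (x : I -> M)
    (U : M -> Prop) :=
  [/\ forall i, U (x i), indep_mod W x & spans_mod W x U].

(** The dimension of [U / (U :&: W)]. *)
Definition has_codim (M : lmodType R) (U W : M -> Prop) (d : nat) :=
  exists (I : finType) (x : I -> M), #|I| = d /\ basis_mod W x U.

Definition fin_spanned (M : lmodType R) (W U : M -> Prop) :=
  exists (I : finType) (x : I -> M), spans_mod W x U.

Section Basics.
Variable M : lmodType R.
Implicit Types (U W Z : M -> Prop) (I J : finType).

Lemma combZ I a (c : I -> K) (x : I -> M) :
  comb (fun i => a * c i) x = iota a *: comb c x.
Proof. by rewrite scaler_sumr; apply: eq_bigr => i _; rewrite rmorphM scalerA. Qed.

Lemma comb0 I (x : I -> M) : comb (fun=> 0) x = 0.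
Proof. by apply: big1 => i _; rewrite rmorph0 scale0r. Qed.

Lemma comb_comb I J (c : I -> K) (d : I -> J -> K) (y : J -> M) :
  comb c (fun i => comb (d i) y) = comb (fun j => \sum_i c i * d i j) y.
Proof.
rewrite /comb; under eq_bigr do rewrite scaler_sumr.
rewrite exchange_big; apply: eq_bigr => j _.
by rewrite rmorph_sum scaler_suml; apply: eq_bigr => i _; rewrite rmorphM scalerA.
Qed.

Lemma comb_sum I J (c : I + J -> K) (x : I + J -> M) :
  comb c x = comb (c \o inl) (x \o inl) + comb (c \o inr) (x \o inr).
Proof. exact: big_sumType. Qed.

Lemma comb_reindex I J (h : I -> J) c (x : J -> M) :
  bijective h -> comb c x = comb (c \o h) (x \o h).
Proof. by move=> hb; rewrite /comb (reindex h) //; apply: onW_bij. Qed.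

Section Subspace.
Variables (W : M -> Prop) (kW : kspace W).

Lemma kspace0 : W 0. Proof. by case: kW. Qed.

Lemma kspaceD x y : W x -> W y -> W (x + y).
Proof. by move=> Wx Wy; rewrite -[x]scale1r -(rmorph1 iota); apply: kW.2. Qed.

Lemma kspaceZ c x : W x -> W (iota c *: x).
Proof. by move=> Wx; rewrite -[_ *: _]addr0; apply: kW.2 => //; apply: kspace0. Qed.

Lemma kspaceN x : W x -> W (- x).
Proof. by move=> Wx; rewrite -scaleN1r -(rmorph1 iota) -rmorphN; apply: kspaceZ. Qed.

Lemma kspaceB x y : W x -> W y -> W (x - y).
Proof. by move=> Wx Wy; apply: kspaceD => //; apply: kspaceN. Qed.

Lemma kspace_sum (I : Type) (r : seq I) (P : pred I) (F : I -> M) :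
  (forall i, P i -> W (F i)) -> W (\sum_(i <- r | P i) F i).
Proof. by move=> WF; apply: big_ind => //; [apply: kspace0|apply: kspaceD]. Qed.

Lemma kspace_comb (I : finType) c (x : I -> M) : (forall i, W (x i)) -> W (comb c x).
Proof. by move=> Wx; apply: kspace_sum => i _; apply: kspaceZ. Qed.

(** Otherwise the matrix expressing [x] through [y] would have more rows than
   columns, and a nonzero vector in its row kernel would be a dependency. *)
Lemma steinitz (I J : finType) (x : I -> M) (y : J -> M) :
  indep_mod W x -> spans_mod W y (fun u => exists i, u = x i) -> (#|I| <= #|J|)%N.
Proof.
move=> xI sp.
have [C CP] := choice (fun i => sp (x i) (ex_intro _ i erefl)).
rewrite leqNgt; apply/negP => ltJI.
pose A := \matrix_(i < #|I|, j < #|J|) C (enum_val i) (enum_val j).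
have : kermx A != 0.
  by rewrite kermx_eq0 /row_free neq_ltn (leq_ltn_trans (rank_leq_col _) ltJI).
case/rowV0Pn => z /sub_kermxP zA /eqP z0; apply: z0.
pose c i := z 0 (enum_rank i).
have : W (comb c x).
  have -> : comb c x = \sum_i iota (c i) *: (x i - comb (C i) y)
              + comb c (fun i => comb (C i) y).
    by rewrite /comb -big_split; apply: eq_bigr => i _; rewrite /= -scalerDr subrK.
  rewrite comb_comb; apply: kspaceD.
    by apply: kspace_sum => i _; apply: kspaceZ.
  rewrite (_ : comb _ _ = 0); first exact: kspace0.
  rewrite -[RHS](comb0 y); congr comb; apply: funext => j.
  have := congr1 (fun B : 'rV_ _ => B 0 (enum_rank j)) zA.
  rewrite !mxE => zj; rewrite -[RHS]zj (reindex (@enum_rank I)) /=; last first.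
    exact/onW_bij/enum_rank_bij.
  by apply: eq_bigr => i _; rewrite mxE !enum_rankK.
move/xI => c0; apply/rowP => i; rewrite mxE.
by have := c0 (enum_val i); rewrite /c enum_valK.
Qed.

(** A longest independent family of vectors of [H] is a basis, since a vector
   outside of its span could be added to it. *)
Lemma basis_exists (J : finType) (y : J -> M) (H : M -> Prop) :
  spans_mod W y H -> exists d (x : 'I_d -> M), basis_mod W x H.
Proof.
move=> sp.
pose P d := `[< exists (I : finType) (x : I -> M),
                  [/\ #|I| = d, forall i, H (x i) & indep_mod W x] >].
have P0 : exists d, P d.
  exists 0%N; apply/asboolP; exists void, (fun v : void => match v with end).
  by split; [rewrite card_void|case|move=> c _ []].
have Pb d : P d -> (d <= #|J|)%N.
  case/asboolP => I [x [<- xH xI]]; apply: steinitz xI _ => u [i ->].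
  exact: sp.
case: (ex_maxnP P0 Pb) => d /asboolP[I [x [Id xH xI]]] dmax.
exists #|I|, (fun i => x (enum_val i)).
have eE c : comb c (fun i : 'I_#|I| => x (enum_val i)) = comb (c \o enum_rank) x.
  by rewrite (comb_reindex _ _ (enum_rank_bij I)); congr comb; apply: funext => i /=;
    rewrite enum_rankK.
split=> // [c|u Hu].
  by rewrite eE => /xI c0 i; rewrite -[i]enum_valK; apply: c0.
suff [c cP] : exists c, W (u - comb c x).
  by exists (c \o enum_val); rewrite eE (_ : _ \o _ = c) //;
    apply: funext => i /=; rewrite enum_rankK.
apply: contrapT => nsp.
pose x' (i : I + unit) := match i with inl i => x i | inr _ => u end.
(* [u] is outside of the span of [x], so it extends [x] to a longer family *)
have : P d.+1.
  apply/asboolP; exists (I + unit)%type, x'; split.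
  - by rewrite card_sum card_unit Id addn1.
  - by case.
  move=> c; rewrite comb_sum.
  have -> : comb (c \o inr) (x' \o inr) = iota (c (inr tt)) *: u.
    by rewrite /comb (big_pred1 tt) //; case.
  have [c0|c0] := eqVneq (c (inr tt)) 0.
    rewrite c0 rmorph0 scale0r addr0 => /xI cI [i|[]] //; exact: cI.
  move=> h; case: nsp; exists (fun i => - (c (inr tt))^-1 * c (inl i)).
  rewrite combZ rmorphN scaleNr opprK.
  have := kspaceZ (c (inr tt))^-1 h.
  by rewrite scalerDr scalerA -rmorphM mulVf // rmorph1 scale1r addrC.
by move/dmax; rewrite ltnn.
Qed.

Lemma spans_mod_sum (I J : finType) (x : I -> M) (U : M -> Prop) (F : J -> M) :
  spans_mod W x U -> (forall j, U (F j)) -> exists c, W (\sum_j F j - comb c x).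
Proof.
move=> sp UF; have [C CP] := choice (fun j => sp _ (UF j)).
exists (fun i => \sum_j 1 * C j i); rewrite -comb_comb.
rewrite (_ : comb _ _ = \sum_j comb (C j) x).
  by rewrite -sumrB; apply: kspace_sum => j _.
by apply: eq_bigr => j _; rewrite rmorph1 scale1r.
Qed.

Lemma has_codim_uniq (U : M -> Prop) d d' :
  has_codim U W d -> has_codim U W d' -> d = d'.
Proof.
move=> [I [x [<- [xU xI xS]]]] [J [y [<- [yU yI yS]]]].
apply/eqP; rewrite eqn_leq; apply/andP; split.
  by apply: steinitz xI _ => _ [i ->]; apply: yS.
by apply: steinitz yI _ => _ [i ->]; apply: xS.
Qed.

Lemma has_codim_exists (U : M -> Prop) : fin_spanned W U -> exists d, has_codim U W d.
Proof.
move=> [J [y yS]]; have [d [x xB]] := basis_exists yS.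
by exists d, 'I_d, x; rewrite card_ord.
Qed.

End Subspace.

Definition join_fam I J (x : I -> M) (y : J -> M) (i : I + J) : M :=
  match i with inl i => x i | inr j => y j end.

Lemma basis_mod_tower U W Z (I J : finType) (x : I -> M) (y : J -> M) :
  kspace W -> (forall z, Z z -> W z) -> (forall w, W w -> U w) ->
  basis_mod W x U -> basis_mod Z y W -> basis_mod Z (join_fam y x) U.
Proof.
move=> kW ZW WU [xU xI xS] [yU yI yS]; split.
- by case=> [j|i] //=; apply: WU.
- move=> c; rewrite comb_sum => h.
  have c0 : forall i, c (inr i) = 0.
    apply: xI; have /(kspaceB kW (ZW _ h)) := kspace_comb kW (c \o inl) yU.
    by rewrite addrC addKr.
  have : Z (comb (c \o inl) y).
    move: h; rewrite (_ : comb (c \o inr) _ = 0) ?addr0 // -[RHS](comb0 x).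
    by congr comb; apply: funext => i /=; apply: c0.
  by move=> /yI c1 [j|i]; [apply: c1|apply: c0].
move=> u /xS[c /yS[c' h]].
exists (fun i => match i with inl j => c' j | inr i => c i end).
by rewrite comb_sum opprD addrA addrAC.
Qed.

Lemma has_codim_tower U W Z a b :
  kspace W -> (forall z, Z z -> W z) -> (forall w, W w -> U w) ->
  has_codim U W a -> has_codim W Z b -> has_codim U Z (a + b).
Proof.
move=> kW ZW WU [I [x [<- xB]]] [J [y [<- yB]]].
exists (J + I)%type, (join_fam y x); rewrite card_sum addnC; split=> //.
exact: basis_mod_tower xB yB.
Qed.

Lemma fin_spanned_sub W U U' : (forall u, U u -> U' u) ->
  fin_spanned W U' -> fin_spanned W U.
Proof. by move=> UU' [I [x xS]]; exists I, x => u /UU'/xS. Qed.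

Lemma fin_spanned_mod W U : kspace W -> (forall u, U u -> W u) -> fin_spanned W U.
Proof.
move=> kW UW; exists void, (fun v : void => match v with end) => u Uu.
exists (fun=> 0); rewrite comb0 subr0; exact: UW.
Qed.

Lemma fin_spanned_line W y : kspace W -> fin_spanned W (fun u => exists c, u = iota c *: y).
Proof.
move=> kW; exists unit, (fun=> y) => u [c ->]; exists (fun=> c).
by rewrite /comb (big_pred1 tt) ?subrr; [apply: kspace0|case].
Qed.

Lemma fin_spanned_add W U U' : kspace W -> fin_spanned W U -> fin_spanned W U' ->
  fin_spanned W (fun u => exists x y, [/\ U x, U' y & u = x + y]).
Proof.
move=> kW [I [x xS]] [J [y yS]]; exists (I + J)%type, (join_fam x y).
move=> u [a [b [/xS[c cP] /yS[c' c'P] ->]]].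
exists (fun i => match i with inl i => c i | inr j => c' j end).
rewrite comb_sum opprD addrACA; exact: kspaceD.
Qed.

Lemma fin_spanned_sum W (T : finType) (U : T -> M -> Prop) : kspace W ->
  (forall t, fin_spanned W (U t)) ->
  fin_spanned W (fun u => exists F, (forall t, U t (F t)) /\ u = \sum_t F t).
Proof.
move=> kW fU.
suff: forall r : seq T, fin_spanned W
    (fun u => exists F, (forall t, U t (F t)) /\ u = \sum_(t <- r) F t).
  by move/(_ (index_enum T)).
elim=> [|t r IHr].
  apply: fin_spanned_mod => // u [F [_ ->]]; rewrite big_nil; exact: kspace0.
apply: fin_spanned_sub (fin_spanned_add kW (fU t) IHr) => u [F [UF ->]].
exists (F t), (\sum_(t <- r) F t); split=> //; first by exists F.
by rewrite big_cons.
Qed.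

End Basics.

Section Transfer.
Variables (M M' : lmodType R) (f : M -> M').
Hypothesis flin : forall c x y, f (iota c *: x + y) = iota c *: f x + f y.

Lemma klin0 : f 0 = 0.
Proof.
have := flin 1 0 0; rewrite rmorph1 !scale1r addr0.
by move=> /esym/(canRL (addKr _)); rewrite addNr.
Qed.

Lemma klinD x y : f (x + y) = f x + f y.
Proof. by have := flin 1 x y; rewrite rmorph1 !scale1r. Qed.

Lemma klinZ c x : f (iota c *: x) = iota c *: f x.
Proof. by have := flin c x 0; rewrite klin0 !addr0. Qed.

Lemma klin_sum (I : Type) (r : seq I) (F : I -> M) :
  f (\sum_(i <- r) F i) = \sum_(i <- r) f (F i).
Proof. exact: (big_morph f klinD klin0). Qed.

Lemma klin_comb (I : finType) c (x : I -> M) : f (comb c x) = comb c (f \o x).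
Proof. by rewrite klin_sum; apply: eq_bigr => i _; rewrite klinZ. Qed.

Lemma klinB x y : f (x - y) = f x - f y.
Proof.
rewrite klinD -scaleN1r -(rmorph1 iota) -rmorphN klinZ.
by rewrite rmorphN rmorph1 scaleN1r.
Qed.

Lemma fin_spanned_im (W U : M -> Prop) (W' : M' -> Prop) :
  (forall w, W w -> W' (f w)) -> fin_spanned W U ->
  fin_spanned W' (fun u => exists2 x, U x & u = f x).
Proof.
move=> fW [I [x xS]]; exists I, (f \o x) => _ [u /xS[c /fW h] ->].
by exists c; rewrite -klin_comb -klinB.
Qed.

Lemma has_codim_im (U W : M -> Prop) (U' W' : M' -> Prop) d :
  kspace U -> (forall u, U u -> U' (f u)) ->
  (forall u', U' u' -> exists2 u, U u & f u = u') ->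
  (forall u, U u -> W u <-> W' (f u)) -> has_codim U W d -> has_codim U' W' d.
Proof.
move=> kU fU fS fW [I [x [Id [xU xI xS]]]]; exists I, (f \o x); split=> //.
split=> [i|c|u' /fS[u Uu <-]]; first exact/fU/xU.
  by rewrite -klin_comb => h; apply: xI; apply/(fW _ (kspace_comb kU _ xU)).
have [c cP] := xS _ Uu; exists c; rewrite -klin_comb -klinB.
by apply/fW => //; apply: kspaceB => //; apply: kspace_comb.
Qed.

End Transfer.
End RelativeDimension.

(** * Relations in a Leavitt path algebra *)

Section LeavittRelations.
Variables (K : fieldType) (V : finType) (E : digraph V).

Local Notation L := (LPA K E).
Local Notation vtx := (lpa_vertex K E).
Local Notation eg := (@lpa_edge K V E).
Local Notation gh := (@lpa_ghost K V E).

Lemma lpa_clM x y : lpa_cl x * lpa_cl y = lpa_cl (LMul x y) :> L.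
Proof. exact: lpa_mulE. Qed.

Lemma lpa_clD x y : lpa_cl x + lpa_cl y = lpa_cl (LAdd x y) :> L.
Proof. exact: lpa_addE. Qed.

Lemma lpa_clZ a x : a *: lpa_cl x = lpa_cl (LScale a x) :> L.
Proof. exact: lpa_scaleE. Qed.

Lemma lpa_clN x : - lpa_cl x = lpa_cl (LOpp x) :> L.
Proof. exact: lpa_oppE. Qed.

Lemma lpa_cl0 : lpa_cl (LZero K E) = 0 :> L.
Proof. by []. Qed.

Lemma lpa_1E : 1 = \sum_v vtx v.
Proof. by []. Qed.

Lemma vtxM v w : vtx v * vtx w = if v == w then vtx v else 0.
Proof.
rewrite lpa_clM -lpa_cl0; case: eqVneq => [<-|vw]; first exact/lpa_clE/lpa_VV.
exact/lpa_clE/lpa_VW.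
Qed.

Lemma vtx_ghost v e : vtx v * gh e = if v == tgt e then gh e else 0.
Proof.
have h : gh e = vtx (tgt e) * gh e by rewrite lpa_clM; apply/esym/lpa_clE/lpa_E2l.
by rewrite {1}h mulrA vtxM; case: eqVneq => [->|_]; rewrite ?mul0r -?h.
Qed.

Lemma ghost_vtx v e : gh e * vtx v = if src e == v then gh e else 0.
Proof.
have h : gh e = gh e * vtx (src e) by rewrite lpa_clM; apply/esym/lpa_clE/lpa_E2r.
by rewrite {1}h -mulrA vtxM; case: eqVneq => _; rewrite ?mulr0 -?h.
Qed.

Lemma ghost_edge e f : gh e * eg f = if e == f then vtx (tgt e) else 0.
Proof.
rewrite lpa_clM -lpa_cl0; case: eqVneq => [<-|vw]; first exact/lpa_clE/lpa_CK1.
exact/lpa_clE/lpa_CK1'.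
Qed.

Lemma vtx_CK2 (e0 : edge E) :
  vtx (src e0) = \sum_(e : edge E | src e == src e0) eg e * gh e.
Proof.
transitivity (lpa_cl (\big[@LAdd K V E/LZero K E]_(e : edge E | src e == src e0)
                 LMul (LEdge K e) (LGhost K e)) : L).
  by apply/lpa_clE/lpa_CK2; rewrite (cardD1 e0) inE eqxx.
rewrite (big_morph (@lpa_cl K V E) (fun x y => esym (lpa_clD x y)) lpa_cl0).
by apply: eq_bigr => e _; rewrite -lpa_clM.
Qed.

(** Scalars enter every [L]-module through this central morphism, so that
   [K]-subspaces of [L]-modules make sense. *)
Definition scal (c : K) : L := c *: (1 : L).

Fact scal_additive : {morph scal : x y / x - y}.
Proof. by move=> x y; rewrite /scal scalerBl. Qed.

Fact scal_multiplicative : monoid_morphism scal.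
Proof.
split; first by rewrite /scal scale1r.
by move=> x y; rewrite /scal -lpa_scalerAl mul1r scalerA.
Qed.

HB.instance Definition _ := GRing.isZmodMorphism.Build K L scal scal_additive.
HB.instance Definition _ := GRing.isMonoidMorphism.Build K L scal scal_multiplicative.

Lemma scal_mul c x : scal c * x = c *: x.
Proof. by rewrite /scal -lpa_scalerAl mul1r. Qed.

Lemma mul_scal c x : x * scal c = c *: x.
Proof. by rewrite /scal -lpa_scalerAr mulr1. Qed.

Lemma scalC c x : scal c * x = x * scal c.
Proof. by rewrite scal_mul mul_scal. Qed.

Lemma lpa_generated (P : L -> Prop) :
  (forall v, P (vtx v)) -> (forall e, P (eg e)) -> (forall e, P (gh e)) ->
  (forall c, P (scal c)) -> (forall x y, P x -> P y -> P (x + y)) ->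
  (forall x y, P x -> P y -> P (x * y)) -> forall x, P x.
Proof.
move=> Pv Pe Pg Ps PD PM.
elim/lpa_ind; elim=> [v|e|e||x IHx|x IHx y IHy|a x IHx|x IHx y IHy].
- exact: Pv.
- exact: Pe.
- exact: Pg.
- by rewrite lpa_cl0 -(rmorph0 scal).
- by rewrite -lpa_clN -mulN1r -(rmorph1 scal) -rmorphN; apply: PM.
- by rewrite -lpa_clD; apply: PD.
- by rewrite -lpa_clZ -scal_mul; apply: PM.
- by rewrite -lpa_clM; apply: PM.
Qed.

Section NoSinks.
Hypothesis emits : forall v, exists e : edge E, src e = v.

Lemma sum_edge_ghost : \sum_e eg e * gh e = 1.
Proof.
rewrite lpa_1E (partition_big (@src _ E) predT) //=; apply: eq_bigr => v _.
by have [e <-] := emits v; rewrite vtx_CK2.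
Qed.

Lemma edge_ghost_expand (P : lmodType L) (x : P) :
  x = \sum_e eg e *: (gh e *: x).
Proof.
rewrite -[LHS]scale1r -sum_edge_ghost scaler_suml.
by apply: eq_bigr => e _; rewrite scalerA.
Qed.

(** * A faithful representation of the ghost polynomials *)

(** [L] acts on the functions on pairs of an infinite path [p] and an integer:
   [e] removes and [e^*] adds the first edge of [p].  The integer counts the
   edges, and so tells ghost paths of different lengths apart even when [p] is
   periodic. *)
Definition point : Type := (nat -> edge E) * int.

Definition is_path (p : nat -> edge E) : Prop := forall i, tgt (p i) = src (p i.+1).
Definition pcons (e : edge E) (p : nat -> edge E) : nat -> edge E :=
  fun i => if i is i'.+1 then p i' else e.
Definition ptail (p : nat -> edge E) : nat -> edge E := fun i => p i.+1.

Fixpoint path_act (x : lpa_expr K E) (g : point -> K) (z : point) {struct x} : K :=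
  match x with
  | LVertex v => if `[< is_path z.1 >] && (src (z.1 0%N) == v) then g z else 0
  | LEdge e => if `[< is_path z.1 >] && (z.1 0%N == e)
               then g (ptail z.1, z.2 + 1) else 0
  | LGhost e => if `[< is_path z.1 >] && (src (z.1 0%N) == tgt e)
                then g (pcons e z.1, z.2 - 1) else 0
  | LZero => 0
  | LOpp x => - path_act x g z
  | LAdd x y => path_act x g z + path_act y g z
  | LScale a x => a * path_act x g z
  | LMul x y => path_act x (path_act y g) z
  end.

Lemma is_path_tail p : is_path p -> is_path (ptail p).
Proof. by move=> h i; apply: h. Qed.

Lemma is_path_cons e p : is_path p -> src (p 0%N) = tgt e -> is_path (pcons e p).
Proof. by move=> h h0 [|i] //=; apply: h. Qed.

Lemma ptailK p : pcons (p 0%N) (ptail p) = p.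
Proof. by apply: funext; case. Qed.

Lemma path_act_linear x a g h z :
  path_act x (fun z => a * g z + h z) z = a * path_act x g z + path_act x h z.
Proof.
elim: x g h z => [v|e|e||x IHx|x IHx y IHy|b x IHx|x IHx y IHy] g h z /=.
- by case: ifP; rewrite ?mulr0 ?addr0.
- by case: ifP; rewrite ?mulr0 ?addr0.
- by case: ifP; rewrite ?mulr0 ?addr0.
- by rewrite mulr0 addr0.
- by rewrite IHx opprD mulrN.
- by rewrite IHx IHy mulrDr addrACA.
- by rewrite IHx mulrDr mulrCA.
- by rewrite -IHx; congr (path_act x _ z); apply: funext.
Qed.

Lemma path_act_zero x z : path_act x (fun=> 0) z = 0.
Proof.
have := path_act_linear x (-1) (fun=> 0) (fun=> 0) z.
by under eq_fun do rewrite mulr0 addr0; rewrite mulN1r addNr.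
Qed.

Lemma path_act_sound x y : lpa_eq x y -> path_act x = path_act y.
Proof.
move=> h; apply: funext => g; apply: funext => z.
elim: h g z => {x y} //=.
- by move=> x y z _ IH1 _ IH2 g w; rewrite IH1 IH2.
- by move=> x x' _ IH g z; rewrite IH.
- by move=> x x' y y' _ IHx _ IHy g z; rewrite IHx IHy.
- by move=> a x x' _ IH g z; rewrite IH.
- move=> x x' y y' _ IHx _ IHy g z; rewrite IHx; congr (path_act x' _ z).
  exact: funext.
- by move=> x y z g w; rewrite addrA.
- by move=> x y g w; rewrite addrC.
- by move=> x g w; rewrite add0r.
- by move=> x g w; rewrite addNr.
- by move=> a b x g w; rewrite mulrA.
- by move=> x g w; rewrite mul1r.
- by move=> a x y g w; rewrite mulrDr.
- by move=> a b x g w; rewrite mulrDl.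
- move=> x y z g w; have := path_act_linear x 1 (path_act y g) (path_act z g) w.
  by rewrite mul1r => <-; congr (path_act x _ w); apply: funext => u; rewrite mul1r.
- move=> a x y g w; have := path_act_linear x a (path_act y g) (fun=> 0) w.
  rewrite path_act_zero addr0 => <-; congr (path_act x _ w).
  by apply: funext => u; rewrite addr0.
- by move=> v g z; case: (_ && _).
- move=> v w vw g z; case: ifP => // /andP[_ /eqP ->].
  by rewrite (negPf vw) andbF.
- move=> e g z; case: asboolP => //= zp.
  by have [<-|_] := eqVneq (z.1 0%N) e; [rewrite eqxx|rewrite if_same].
- move=> e g z; case: asboolP => //= zp; have [<-|//] := eqVneq (z.1 0%N) e.
  by rewrite asboolT ?(zp 0%N) ?eqxx //; apply: is_path_tail.
- by move=> e g z; case: asboolP => //= zp; case: (_ == _).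
- move=> e g z; case: asboolP => //= zp; case: eqVneq => // ze.
  by rewrite asboolT ?eqxx //; apply: is_path_cons.
- move=> e g [p d] /=; case: asboolP => //= zp; case: eqVneq => // ze.
  by rewrite asboolT ?eqxx ?subrK //; apply: is_path_cons.
- move=> e f ef g [p d] /=; case: asboolP => //= zp; case: eqVneq => // ze.
  by rewrite (negPf ef) andbF.
move=> v _ g z.
rewrite (big_morph (fun x => path_act x g z) (id1 := 0) (op1 := +%R)) //=.
case: asboolP => zp /=; last by rewrite big1.
case: eqVneq => [zv|zv].
  rewrite (bigD1 (z.1 0%N)) ?zv //= eqxx asboolT; last exact: is_path_tail.
  rewrite (zp 0%N) eqxx /= ptailK addrK -surjective_pairing big1 ?addr0 //.
  by move=> e /andP[_ /negPf]; rewrite eq_sym => ->.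
rewrite big1 // => e /eqP ev; case: eqVneq => // ze.
by rewrite ze ev eqxx in zv.
Qed.

Definition lpa_act (x : L) : (point -> K) -> point -> K := path_act (repr x).

Lemma lpa_act_cl x : lpa_act (lpa_cl x) = path_act x.
Proof. exact/path_act_sound/lpa_repr. Qed.

Lemma lpa_actD x y g z : lpa_act (x + y) g z = lpa_act x g z + lpa_act y g z.
Proof. by elim/lpa_ind: x => x; elim/lpa_ind: y => y; rewrite lpa_clD !lpa_act_cl. Qed.

Lemma lpa_actM x y g z : lpa_act (x * y) g z = lpa_act x (lpa_act y g) z.
Proof. by elim/lpa_ind: x => x; elim/lpa_ind: y => y; rewrite lpa_clM !lpa_act_cl. Qed.

Lemma lpa_actZ a x g z : lpa_act (a *: x) g z = a * lpa_act x g z.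
Proof. by elim/lpa_ind: x => x; rewrite lpa_clZ !lpa_act_cl. Qed.

Lemma lpa_act0 g z : lpa_act 0 g z = 0.
Proof. by rewrite -lpa_cl0 lpa_act_cl. Qed.

Lemma lpa_act_sum (I : Type) (r : seq I) (P : pred I) (F : I -> L) g z :
  lpa_act (\sum_(i <- r | P i) F i) g z = \sum_(i <- r | P i) lpa_act (F i) g z.
Proof. by apply: (big_morph (fun x => lpa_act x g z)) => [x y|]; rewrite ?lpa_actD ?lpa_act0. Qed.

(** * Ghost polynomials *)

(** The [K]-combinations of ghost paths of length less than [k], the vertices
   being the ghost paths of length [0].  The union over [k] is the path algebra
   of the opposite graph, of which [L] is a localization. *)
Fixpoint gpoly (k : nat) : L -> Prop :=
  if k is k'.+1 then fun x => exists (c : V -> K) (y : edge E -> L),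
    (forall e, gpoly k' (y e)) /\
    x = \sum_v scal (c v) * vtx v + \sum_e gh e * y e
  else fun x => x = 0.

Definition is_gpoly x := exists k, gpoly k x.

Lemma gpoly0 k : gpoly k 0.
Proof.
case: k => // k; exists (fun=> 0), (fun=> 0).
elim: k => [|k IHk]; last first.
  have [_ IH] := IHk; split=> // e; exists (fun=> 0), (fun=> 0) => /=.
  by split=> // e'; apply: IHk.1.
split=> //; rewrite !big1 ?addr0 // => [e|v] _; first by rewrite mulr0.
by rewrite rmorph0 mul0r.
Qed.

Lemma gpolyD k x y : gpoly k x -> gpoly k y -> gpoly k (x + y).
Proof.
elim: k x y => [|k IHk] x y /=; first by move=> -> ->; rewrite addr0.
move=> [c [u [uk ->]]] [d [w [wk ->]]].
exists (fun v => c v + d v), (fun e => u e + w e); split=> [e|]; first exact: IHk.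
rewrite addrACA -!big_split; congr (_ + _); apply: eq_bigr => i _ /=.
  by rewrite rmorphD mulrDl.
by rewrite mulrDr.
Qed.

Lemma gpolyZ k c x : gpoly k x -> gpoly k (scal c * x).
Proof.
elim: k x => [|k IHk] x /=; first by move=> ->; rewrite mulr0.
move=> [d [u [uk ->]]].
exists (fun v => c * d v), (fun e => scal c * u e); split=> [e|]; first exact: IHk.
rewrite mulrDr !mulr_sumr; congr (_ + _); apply: eq_bigr => i _ /=.
  by rewrite rmorphM mulrA.
by rewrite !mulrA scalC.
Qed.

Lemma gpolyN k x : gpoly k x -> gpoly k (- x).
Proof. by move=> /(gpolyZ (-1)); rewrite rmorphN1 mulN1r. Qed.

Lemma gpolyB k x y : gpoly k x -> gpoly k y -> gpoly k (x - y).
Proof. by move=> hx hy; apply: gpolyD => //; apply: gpolyN. Qed.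

Lemma gpoly_sum k (I : Type) (r : seq I) (P : pred I) (F : I -> L) :
  (forall i, P i -> gpoly k (F i)) -> gpoly k (\sum_(i <- r | P i) F i).
Proof. by move=> h; apply: big_ind => //; [apply: gpoly0|apply: gpolyD]. Qed.

Lemma gpoly_ghost k e x : gpoly k x -> gpoly k.+1 (gh e * x).
Proof.
move=> hx; exists (fun=> 0), (fun f => if f == e then x else 0); split=> [f|].
  by case: ifP => // _; apply: gpoly0.
rewrite [X in X + _]big1 ?add0r => [|v _]; last by rewrite rmorph0 mul0r.
rewrite (bigD1 e) //= eqxx big1 ?addr0 // => f /negPf ->.
by rewrite mulr0.
Qed.

Lemma gpolyS k x : gpoly k x -> gpoly k.+1 x.
Proof.
elim: k x => [|k IHk] x; first by move=> ->; apply: gpoly0.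
by move=> [c [y [yk ->]]]; exists c, y; split=> // e; apply/IHk/yk.
Qed.

Lemma gpoly_le k k' x : (k <= k')%N -> gpoly k x -> gpoly k' x.
Proof.
move=> /subnK <-; elim: (k' - k)%N => // d IHd hx.
by rewrite addSn; apply/gpolyS/IHd.
Qed.

Lemma gpoly_vtx v : gpoly 1 (vtx v).
Proof.
exists (fun w => (w == v)%:R), (fun=> 0); split=> //.
rewrite [X in _ + X]big1 ?addr0 => [|e _]; last by rewrite mulr0.
rewrite (bigD1 v) //= eqxx rmorph1 mul1r big1 ?addr0 // => w /negPf ->.
by rewrite rmorph0 mul0r.
Qed.

Lemma gpoly_mul_vtx k v x : gpoly k x -> gpoly k (x * vtx v).
Proof.
elim: k x => [|k IHk] x; first by move=> ->; rewrite mul0r.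
move=> [c [y [yk ->]]]; rewrite mulrDl !mulr_suml; apply: gpolyD.
  apply: gpoly_sum => w _; rewrite -mulrA vtxM; apply: gpolyZ.
  by case: eqP => _; [apply: gpoly_le (gpoly_vtx w)|apply: gpoly0].
by apply: gpoly_sum => e _; rewrite -mulrA; apply/gpoly_ghost/IHk/yk.
Qed.

Lemma vtx_mul_gpoly k v x : gpoly k x -> gpoly k (vtx v * x).
Proof.
case: k x => [|k] x; first by move=> ->; rewrite mulr0.
move=> [c [y [yk ->]]]; rewrite mulrDr !mulr_sumr; apply: gpolyD.
  apply: gpoly_sum => w _; rewrite mulrA -scalC -mulrA vtxM; apply: gpolyZ.
  by case: eqP => _; [apply: gpoly_le (gpoly_vtx _)|apply: gpoly0].
apply: gpoly_sum => e _; rewrite mulrA vtx_ghost.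
by case: eqP => _; [apply/gpoly_ghost/yk|rewrite mul0r; apply: gpoly0].
Qed.

(** Multiplying a ghost path by an edge on the right removes its last letter;
   only a vertex can produce an edge, which the ghost edge on the left absorbs. *)
Lemma gpoly_ghost_edge k e f x : gpoly k x -> gpoly k (gh e * x * eg f).
Proof.
elim: k x e => [|k IHk] x e; first by move=> ->; rewrite mulr0 mul0r.
move=> [c [y [yk ->]]]; rewrite mulrDr mulrDl !mulr_sumr !mulr_suml.
apply: gpolyD; last first.
  apply: gpoly_sum => g _; rewrite -mulrA; apply/gpoly_ghost.
  exact/IHk/yk.
apply: gpoly_sum => v _; rewrite mulrA -scalC -!mulrA; apply: gpolyZ.
rewrite mulrA ghost_vtx; case: eqP => _; last by rewrite mul0r; apply: gpoly0.
rewrite ghost_edge; case: eqP => _; last exact: gpoly0.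
exact: gpoly_le (gpoly_vtx _).
Qed.

(** Splitting off the last ghost edges instead of the first ones expresses the
   multiples of [x] by ghost polynomials through those of the [e^* x]. *)
Lemma gpoly_recr k x : gpoly k.+1 x -> exists (c : V -> K) (y : edge E -> L),
  (forall e, gpoly k (y e)) /\
  x = \sum_v scal (c v) * vtx v + \sum_e y e * gh e.
Proof.
elim: k x => [|k IHk] x [c [y [yk xE]]].
  exists c, (fun=> 0); split=> //; rewrite xE; congr (_ + _).
  by apply: eq_bigr => e _; rewrite (yk e) mulr0 mul0r.
have [d dP] := choice (fun e => IHk _ (yk e)).
have [z zP] := choice dP.
exists c, (fun f => scal (d f (src f)) * vtx (tgt f) + \sum_e gh e * z e f).
split=> [f|].
  apply: gpolyD; first by apply: gpolyZ; apply: gpoly_le (gpoly_vtx _).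
  by apply: gpoly_sum => e _; apply/gpoly_ghost/(zP e).1.
rewrite xE; congr (_ + _).
under [RHS]eq_bigr do rewrite mulrDl mulr_suml.
rewrite big_split exchange_big -big_split; apply: eq_bigr => e _ /=.
rewrite {1}(zP e).2 mulrDr; congr (_ + _); last first.
  by rewrite mulr_sumr; apply: eq_bigr => f _; rewrite mulrA.
rewrite -mulrA vtx_ghost eqxx mulr_sumr (bigD1 (src e)) //= big1 ?addr0 => [|v].
  by rewrite mulrA -scalC -mulrA ghost_vtx eqxx.
by rewrite eq_sym => /negPf ne; rewrite mulrA -scalC -mulrA ghost_vtx ne mulr0.
Qed.

Lemma lpa_act_ghost e g p d : is_path p -> src (p 0%N) = tgt e ->
  lpa_act (gh e) g (p, d) = g (pcons e p, d - 1).
Proof. by move=> pp pe; rewrite lpa_act_cl /= asboolT //= pe eqxx. Qed.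

Lemma lpa_act_ghost0 e g p d : src (p 0%N) <> tgt e -> lpa_act (gh e) g (p, d) = 0.
Proof. by move=> pe; rewrite lpa_act_cl /=; case: eqP => //; rewrite andbF. Qed.

Lemma lpa_act_vtx v g p d : is_path p ->
  lpa_act (vtx v) g (p, d) = if src (p 0%N) == v then g (p, d) else 0.
Proof. by move=> pp; rewrite lpa_act_cl /= asboolT. Qed.

(** The points from which [(p, d)] is reached by removing edges. *)
Definition above (p : nat -> edge E) (d : int) (z : point) : Prop :=
  exists i : nat, (forall j, z.1 (i + j)%N = p j) /\ z.2 = d - i%:Z.

Lemma above_refl p d : above p d (p, d).
Proof. by exists 0%N; split=> //=; rewrite subr0. Qed.

Lemma above_cons e p d z : above (pcons e p) (d - 1) z -> above p d z.
Proof.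
move=> [i [h1 h2]]; exists i.+1; split=> [j|]; first by rewrite addSnnS h1.
by rewrite h2 -addn1 PoszD opprD addrAC addrA.
Qed.

Lemma lpa_act_gpoly_vtx (c : V -> K) g p d : is_path p ->
  lpa_act (\sum_v scal (c v) * vtx v) g (p, d) = c (src (p 0%N)) * g (p, d).
Proof.
move=> pp; rewrite lpa_act_sum (bigD1 (src (p 0%N))) //= big1 ?addr0 => [|v].
  by rewrite scal_mul lpa_actZ lpa_act_vtx // eqxx.
by rewrite eq_sym => /negPf ne; rewrite scal_mul lpa_actZ lpa_act_vtx // ne mulr0.
Qed.

(** A ghost edge moves the point of evaluation up by one edge, and a vertex
   does not move it. *)
Lemma lpa_act_local k y : gpoly k y -> forall g h p d, is_path p ->
  (forall z, above p d z -> g z = h z) -> lpa_act y g (p, d) = lpa_act y h (p, d).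
Proof.
elim: k y => [|k IHk] y; first by move=> -> g h p d _ _; rewrite !lpa_act0.
move=> [c [u [uk ->]]] g h p d pp gh_.
rewrite !lpa_actD !lpa_act_gpoly_vtx // gh_; last exact: above_refl.
congr (_ + _); rewrite !lpa_act_sum; apply: eq_bigr => e _; rewrite !lpa_actM.
have [pe|pe] := eqVneq (src (p 0%N)) (tgt e); last first.
  by rewrite !lpa_act_ghost0 //; apply/eqP.
rewrite !lpa_act_ghost //; apply: (IHk (u e) (uk e)) => //; first exact: (is_path_cons pp pe).
by move=> z /above_cons; apply: gh_.
Qed.

(** In [\sum_v c v v + \sum_e e^* y e], the term at [e] evaluated at [(p, d)]
   only looks at points above [(ep, d - 1)], and these sets are disjoint for
   different [e] and do not contain [(p, d)]: testing on functions supported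
   on one of them separates the terms. *)
Lemma lpa_act_separate (c : V -> K) (y : edge E -> L) p d :
  (forall e, is_gpoly (y e)) -> is_path p ->
  (forall g, lpa_act (\sum_v scal (c v) * vtx v + \sum_e gh e * y e) g (p, d) = 0) ->
  c (src (p 0%N)) = 0 /\
  forall e, src (p 0%N) = tgt e -> forall g, lpa_act (y e) g (pcons e p, d - 1) = 0.
Proof.
move=> yg pp h0.
have hE g : c (src (p 0%N)) * g (p, d) +
    \sum_(e | src (p 0%N) == tgt e) lpa_act (y e) g (pcons e p, d - 1) = 0.
  rewrite -[RHS](h0 g) lpa_actD lpa_act_gpoly_vtx //; congr (_ + _).
  rewrite lpa_act_sum big_mkcond; apply: eq_bigr => e _; rewrite lpa_actM.
  case: eqP => [pe|pe]; [by rewrite lpa_act_ghost|by rewrite lpa_act_ghost0].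
have yloc e g : (forall z, above (pcons e p) (d - 1) z -> g z = 0) ->
    src (p 0%N) = tgt e -> lpa_act (y e) g (pcons e p, d - 1) = 0.
  move=> gz pe; have [k yk] := yg e.
  have pep := is_path_cons pp pe.
  rewrite (lpa_act_local yk (h := fun=> 0) pep gz).
  by elim/lpa_ind: (y e) => x; rewrite lpa_act_cl path_act_zero.
have disj e f z : above (pcons e p) (d - 1) z -> above (pcons f p) (d - 1) z -> e = f.
  move=> [i [h1 h2]] [j [h3 h4]].
  have ij : i = j by move: h4; rewrite h2 => /addrI/oppr_inj[].
  by rewrite -[e]/(pcons e p 0%N) -h1 ij h3.
split.
  have := hE (fun z => `[< z = (p, d) >]%:R).
  rewrite asboolT // mulr1 big1 ?addr0 // => e /eqP pe; apply: yloc => // z [i [_ h2]].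
  case: asboolP => // zE; move: h2; rewrite zE /= -addrA -[LHS]addr0.
  by move=> /addrI; rewrite -opprD -(PoszD 1 i) => /eqP; rewrite eq_sym oppr_eq0.
move=> e pe g.
pose g' z := if `[< above (pcons e p) (d - 1) z >] then g z else 0.
have := hE g'; rewrite {1}/g' asboolF; last first.
  move=> [i [_ /= h2]]; move: h2; rewrite -addrA -[LHS]addr0.
  by move=> /addrI; rewrite -opprD -(PoszD 1 i) => /eqP; rewrite eq_sym oppr_eq0.
rewrite mulr0 add0r (bigD1 e) ?pe //= big1 ?addr0 => [h|f /andP[/eqP pf fe]].
  have [k yk] := yg e; rewrite -[RHS]h; apply: lpa_act_local yk _ _ _ _ _ _.
    exact: is_path_cons.
  by move=> z ez; rewrite /g' asboolT.
apply: yloc => [z fz|]; last by rewrite pe.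
rewrite /g' asboolF // => ez.
by rewrite (disj _ _ _ fz ez) eqxx in fe.
Qed.

(** Multiplication by the first vertex of [p] keeps the terms of [y] that are fixed
   by this vertex, and by [lpa_act_separate] each of them acts as zero at
   [(p, d)] by itself. *)
Lemma lpa_act_faithful k y : gpoly k y -> forall p d, is_path p ->
  (forall g, lpa_act y g (p, d) = 0) -> vtx (src (p 0%N)) * y = 0.
Proof.
elim: k y => [|k IHk] y; first by move=> -> *; rewrite mulr0.
move=> [c [u [uk ->]]] p d pp h.
have [c0 hu] := lpa_act_separate (fun e => ex_intro _ k (uk e)) pp h.
rewrite mulrDr !mulr_sumr !big1 ?addr0 // => [e|v] _.
  rewrite mulrA vtx_ghost; case: eqP => [pe|_]; last by rewrite mul0r.
  have /= := IHk _ (uk e) (pcons e p) (d - 1) (is_path_cons pp pe) (hu e pe).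
  have ge : gh e * vtx (src e) = gh e by rewrite ghost_vtx eqxx.
  by move=> ue; rewrite -ge -mulrA ue mulr0.
rewrite mulrA -scalC -mulrA vtxM; case: eqP => [<-|_]; last by rewrite mulr0.
by rewrite c0 rmorph0 mul0r.
Qed.

Lemma path_from (v : V) : exists2 p, is_path p & src (p 0%N) = v.
Proof.
have [out outP] := choice emits.
pose p i := iter i (fun e : edge E => out (tgt e)) (out v).
by exists p => [i|]; rewrite /p /= outP.
Qed.

(** This is the linear independence of the ghost paths, which the
   representation separates from each other. *)
Lemma gpoly_unique (c : V -> K) (y : edge E -> L) :
  (forall e, is_gpoly (y e)) ->
  \sum_v scal (c v) * vtx v + \sum_e gh e * y e = 0 ->
  (forall v, c v = 0) /\ (forall e, vtx (src e) * y e = 0).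
Proof.
move=> yg h; split=> [v|e].
  have [p pp <-] := path_from v.
  by have [|] := @lpa_act_separate c y p 0 yg pp; rewrite ?h // => g; apply: lpa_act0.
have [p pp pe] := path_from (tgt e).
have [|_ /(_ e pe) hy] := @lpa_act_separate c y p 0 yg pp.
  by rewrite h => g; apply: lpa_act0.
have [k yk] := yg e.
exact: (lpa_act_faithful yk (is_path_cons pp pe) hy).
Qed.

(** Left multiplication by distinct ghost edges keeps the leading terms
   independent, so the length drops by exactly one. *)
Lemma gpoly_unghost k (y : edge E -> L) : (forall e, is_gpoly (y e)) ->
  gpoly k.+1 (\sum_e gh e * y e) -> forall e, gpoly k (vtx (src e) * y e).
Proof.
move=> yg [c [u [uk h]]] e.
have [||_ /(_ e)] := @gpoly_unique (fun v => - c v) (fun e => y e - u e).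
- move=> f; have [m ym] := yg f; exists (maxn m k).
  apply: gpolyB; [exact: gpoly_le (leq_maxl _ _) ym|].
  exact: gpoly_le (leq_maxr _ _) (uk f).
- under [X in _ + X]eq_bigr do rewrite mulrBr.
  rewrite sumrB h; under [X in X + _]eq_bigr do rewrite rmorphN mulNr.
  by rewrite sumrN addrK addNr.
by rewrite mulrBr => /subr0_eq ->; apply/vtx_mul_gpoly/uk.
Qed.

Lemma gpoly_unghost1 k e x : is_gpoly x -> gpoly k.+1 (gh e * x) ->
  gpoly k (vtx (src e) * x).
Proof.
move=> gx h; pose y f : L := if f == e then x else 0.
have := @gpoly_unghost k y; rewrite (bigD1 e) //= big1 => [|f /negPf fe].
  rewrite /y eqxx addr0 => /(_ _ h e); rewrite eqxx; apply=> f.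
  by case: eqP => // _; exists 0%N.
by rewrite /y fe mulr0.
Qed.

Lemma gpolyM k l x y : gpoly k x -> gpoly l y -> gpoly (k + l) (x * y).
Proof.
move=> + hy; elim: k x => [|k IHk] x; first by move=> ->; rewrite mul0r; apply: gpoly0.
move=> [c [u [uk ->]]]; rewrite addSn mulrDl !mulr_suml; apply: gpolyD.
  apply: gpoly_sum => v _; rewrite -mulrA; apply/gpolyZ/vtx_mul_gpoly.
  by apply: gpoly_le hy; rewrite -addSn leq_addl.
by apply: gpoly_sum => e _; rewrite -mulrA; apply/gpoly_ghost/IHk/uk.
Qed.

Lemma gpoly_fin_spanned k : fin_spanned scal (fun x : L^o => x = 0) (gpoly k).
Proof.
have k0 : kspace scal (fun x : L^o => x = 0).
  by split=> // c x y -> ->; rewrite scaler0 addr0.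
elim: k => [|k IHk]; first by apply: fin_spanned_mod.
have f1 := fin_spanned_sum k0 (fun v => fin_spanned_line (vtx v : L^o) k0).
have f2 (e : edge E) : fin_spanned scal (fun x : L^o => x = 0)
    (fun x : L^o => exists2 u, gpoly k u & x = gh e * u).
  apply: (@fin_spanned_im _ _ _ _ _ (fun x : L^o => gh e * x : L^o)) IHk.
    by move=> c x y; rewrite mulrDr /= /GRing.scale /= !mulrA -scalC.
  by move=> w ->; rewrite mulr0.
apply: fin_spanned_sub (fin_spanned_add k0 f1 (fin_spanned_sum k0 f2)).
move=> x [c [y [yk xE]]].
exists (\sum_v scal (c v) * vtx v), (\sum_e gh e * y e); split=> //.
  by exists (fun v => scal (c v) * vtx v); split=> // v; exists (c v).
by exists (fun e => gh e * y e); split=> // e; exists (y e) => //; apply: yk.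
Qed.

End NoSinks.
End LeavittRelations.

(** * Ghost submodules and denominators *)

Section GhostModules.
Variables (K : fieldType) (V : finType) (E : digraph V).
Hypothesis emits : forall v, exists e : edge E, src e = v.

Local Notation L := (LPA K E).
Local Notation vtx := (lpa_vertex K E).
Local Notation eg := (@lpa_edge K V E).
Local Notation gh := (@lpa_ghost K V E).
Local Notation scal := (@scal K V E).

Section AfterGhosts.
Variable P : lmodType L.
Implicit Types (Q S C : P -> Prop) (x y : P).

Definition ghost_closed Q : Prop :=
  [/\ kspace scal Q, forall v x, Q x -> Q (vtx v *: x)
    & forall e x, Q x -> Q (gh e *: x)].

Definition submodule S : Prop :=
  [/\ S 0, forall x y, S x -> S y -> S (x + y) & forall r x, S x -> S (r *: x)].

(** Ghost paths play the part of denominators: [m] bounds the denominator of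
   [x] with respect to [Q]. *)
Fixpoint after_ghosts Q (m : nat) x : Prop :=
  if m is m'.+1 then forall e, after_ghosts Q m' (gh e *: x) else Q x.

Lemma scalZC c (r : L) x : scal c *: (r *: x) = r *: (scal c *: x).
Proof. by rewrite !scalerA scalC. Qed.

Lemma submodule_sum S (I : Type) (r : seq I) (F : I -> P) :
  submodule S -> (forall i, S (F i)) -> S (\sum_(i <- r) F i).
Proof. by case=> S0 SD _ SF; apply: big_ind. Qed.

Lemma after_kspace Q m : kspace scal Q -> kspace scal (after_ghosts Q m).
Proof.
move=> kQ; elim: m => // m [IH0 IHZ]; split=> [e|c x y hx hy e] /=.
  by rewrite scaler0.
by rewrite scalerDr -scalZC; apply: IHZ.
Qed.

Lemma after_imp Q Q' m x : (forall x, Q x -> Q' x) ->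
  after_ghosts Q m x -> after_ghosts Q' m x.
Proof. by move=> QQ'; elim: m x => [|m IHm] x //=; [apply: QQ'|move=> h e; apply: IHm]. Qed.

Lemma after_and Q C m x : (forall e x, C x -> C (gh e *: x)) -> C x ->
  after_ghosts Q m x -> after_ghosts (fun x => Q x /\ C x) m x.
Proof.
by move=> Cg; elim: m x => [|m IHm] x Cx //= h e; apply: IHm => //; apply: Cg.
Qed.

(** By (CK2), [x] is the sum of the [e (e^* x)], so that multiplying by edges
   undoes the ghosts. *)
Lemma after_submodule S m x : submodule S -> after_ghosts S m x -> S x.
Proof.
move=> sS; elim: m x => //= m IHm x h.
rewrite [x](edge_ghost_expand emits); apply: submodule_sum => // e.
by case: sS => _ _ SZ; apply/SZ/IHm.
Qed.

Section Closed.
Variables (Q : P -> Prop) (gQ : ghost_closed Q).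

Lemma after_next m x : after_ghosts Q m x -> after_ghosts Q m.+1 x.
Proof.
elim: m x => [|m IHm] x h e; first by case: gQ => _ _; apply.
exact/IHm/h.
Qed.

Lemma after_le m m' x : (m <= m')%N -> after_ghosts Q m x -> after_ghosts Q m' x.
Proof.
move=> /subnK <-; elim: (m' - m)%N => // d IHd h.
by rewrite addSn; apply/after_next/IHd.
Qed.

Lemma after_vtx m v x : after_ghosts Q m x -> after_ghosts Q m (vtx v *: x).
Proof.
case: m => [|m] /=; first by case: gQ => _ + _; apply.
move=> h e; rewrite scalerA ghost_vtx; case: eqP => _ //.
rewrite scale0r; exact: kspace0 (after_kspace _ (let: And3 k _ _ := gQ in k)).
Qed.

(** An edge undoes the ghost edge in front of it, so that one more ghost is
   enough after multiplying by it. *)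
Lemma eventually_submodule : submodule (fun x => exists m, after_ghosts Q m x).
Proof.
have kQ : kspace scal Q by case: gQ.
have D x y : (exists m, after_ghosts Q m x) -> (exists m, after_ghosts Q m y) ->
    exists m, after_ghosts Q m (x + y).
  move=> [m hx] [m' hy]; exists (maxn m m').
  apply: (kspaceD (after_kspace (maxn m m') kQ)).
    exact: after_le (leq_maxl _ _) hx.
  exact: after_le (leq_maxr _ _) hy.
split=> //; first by exists 0%N; apply: kspace0 kQ.
move=> r; elim/lpa_generated: r => [v|e|e|c|r s IHr IHs|r s IHr IHs] x.
- by move=> [m hx]; exists m; apply: after_vtx.
- move=> [m hx]; exists m.+1 => f; rewrite scalerA ghost_edge.
  case: eqP => _; first exact: after_vtx.
  rewrite scale0r; exact: kspace0 (after_kspace _ kQ).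
- by move=> [m hx]; exists m; apply: after_next.
- move=> [m hx]; exists m; exact: kspaceZ (after_kspace _ kQ) _ _ hx.
- by move=> hx; rewrite scalerDl; apply: D; [apply: IHr|apply: IHs].
- by move=> hx; rewrite -scalerA; apply/IHr/IHs.
Qed.

End Closed.
End AfterGhosts.

(** ** Rows over the algebra *)

Section Rows.
Variable n : nat.
Implicit Types (x y : 'rV[L]_n) (t : 'I_n -> V).

Definition vdiag t : 'M[L]_n := diag_mx (\row_i vtx (t i)).

Lemma mulmx_vdiag m (A : 'M_(m, n)) t i j : (A *m vdiag t) i j = A i j * vtx (t j).
Proof. by rewrite mul_mx_diag !mxE. Qed.

Lemma vdiag_idem t : vdiag t *m vdiag t = vdiag t.
Proof.
rewrite [LHS]mulmx_diag; congr diag_mx; apply/rowP => i.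
by rewrite !mxE vtxM eqxx.
Qed.

(** The standard generators of the module of rows fixed by [vdiag t]. *)
Definition vunit t i : 'rV[L]_n := vtx (t i) *: delta_mx 0 i.

Lemma vunitE t i j : vunit t i 0 j = if i == j then vtx (t i) else 0.
Proof. by rewrite !mxE eqxx /= eq_sym; case: eqP => _; rewrite ?mulr1 ?mulr0. Qed.

Lemma vunit_vdiag t i : vunit t i *m vdiag t = vunit t i.
Proof.
apply/rowP => j; rewrite mulmx_vdiag vunitE; case: eqP => [<-|_]; last by rewrite mul0r.
by rewrite vtxM eqxx.
Qed.

Lemma comb_vunit t c i : comb scal c (vunit t) 0 i = scal (c i) * vtx (t i).
Proof.
rewrite summxE (bigD1 i) //= big1 ?addr0 => [|j /negPf ji].
  by rewrite mxE vunitE eqxx.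
by rewrite mxE vunitE ji mulr0.
Qed.

Definition gpoly_row k x := forall i, gpoly k (x 0 i).
Definition ghost_row x := exists k, gpoly_row k x.

Lemma gpoly_row_le k k' x : (k <= k')%N -> gpoly_row k x -> gpoly_row k' x.
Proof. by move=> kk h i; apply: gpoly_le kk (h i). Qed.

Lemma gpoly_row_kspace k : kspace scal (gpoly_row k).
Proof.
split=> [i|c x y hx hy i]; rewrite !mxE; first exact: gpoly0.
by apply: gpolyD => //; apply: gpolyZ.
Qed.

Lemma gpoly_row_ghost k e x : gpoly_row k x -> gpoly_row k.+1 (gh e *: x).
Proof. by move=> h i; rewrite mxE; apply: gpoly_ghost. Qed.

Lemma gpoly_row_vtx k v x : gpoly_row k x -> gpoly_row k (vtx v *: x).
Proof. by move=> h i; rewrite mxE; apply: vtx_mul_gpoly. Qed.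

Lemma ghost_row_closed : ghost_closed ghost_row.
Proof.
split=> [|v x [k h]|e x [k h]].
- split=> [|c x y [k hx] [k' hy]]; first by exists 0%N; apply: kspace0 (gpoly_row_kspace 0).
  exists (maxn k k'); apply: (gpoly_row_kspace _).2.
    exact: gpoly_row_le (leq_maxl _ _) hx.
  exact: gpoly_row_le (leq_maxr _ _) hy.
- by exists k; apply: gpoly_row_vtx.
- by exists k.+1; apply: gpoly_row_ghost.
Qed.

Lemma ghost_row_eventually x : exists m, after_ghosts ghost_row m x.
Proof.
have sS := eventually_submodule ghost_row_closed.
rewrite (row_sum_delta x); apply: (submodule_sum _ sS) => i.
case: (sS) => _ _ SZ; apply: SZ; exists 0%N, 1%N => j; rewrite mxE eqxx andTb.
case: eqP => _; rewrite ?mulr0n ?mulr1n; last exact: gpoly0.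
by rewrite lpa_1E; apply: gpoly_sum => v _; apply: gpoly_vtx.
Qed.

(** A lattice in the module of the rows fixed by [vdiag t], which is the direct
   sum of the [L (t i)]. *)
Definition lattice t x := ghost_row x /\ x *m vdiag t = x.

Lemma fixed_ghost m (A : 'M_(n, m)) (z : 'rV[L]_m) x r :
  x *m A = z -> (r *: x) *m A = r *: z.
Proof. by rewrite -scalemxAl => ->. Qed.

Lemma lattice_closed t : ghost_closed (lattice t).
Proof.
have [[r0 rD] rv rg] := ghost_row_closed.
split; [split|..].
- by split; rewrite ?mul0mx.
- move=> c x y [hx dx] [hy dy]; split; first exact: rD.
  by rewrite mulmxDl dy (fixed_ghost _ dx).
- by move=> v x [hx dx]; split; [apply: rv|apply: fixed_ghost].
- by move=> e x [hx dx]; split; [apply: rg|apply: fixed_ghost].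
Qed.

Lemma lattice_eventually t x : x *m vdiag t = x ->
  exists m, after_ghosts (lattice t) m x.
Proof.
move=> dx; have [m hm] := ghost_row_eventually x; exists m.
by apply: after_and => // e y dy; apply: fixed_ghost.
Qed.

Lemma vunit_grow t i : gpoly_row 1 (vunit t i).
Proof.
by move=> j; rewrite vunitE; case: eqP => _; [apply: gpoly_vtx|apply: gpoly0].
Qed.

Lemma vunit_lattice t i : lattice t (vunit t i).
Proof. by split; [exists 1%N; apply: vunit_grow|apply: vunit_vdiag]. Qed.

Lemma vdiag_expand t x : x *m vdiag t = x -> x = \sum_i x 0 i *: vunit t i.
Proof.
move=> dx; apply/rowP => j; rewrite summxE (bigD1 j) //= big1 ?addr0 => [|i /negPf ij].
  by rewrite [RHS]mxE vunitE eqxx -{1}dx mulmx_vdiag.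
by rewrite mxE vunitE ij mulr0.
Qed.

Lemma gpoly_row_rec t k x : gpoly_row k.+1 x -> x *m vdiag t = x ->
  exists (c : 'I_n -> K) (y : edge E -> 'rV[L]_n),
    (forall e, gpoly_row k (y e) /\ y e *m vdiag t = y e) /\
    x = comb scal c (vunit t) + \sum_e gh e *: y e.
Proof.
move=> gx dx.
have [c cP] := choice gx; have [y yP] := choice cP.
exists (fun i => c i (t i)), (fun e => \row_i (y i e * vtx (t i))); split=> [e|].
  split=> [i|]; first by rewrite mxE; apply/gpoly_mul_vtx/(yP i).1.
  by apply/rowP => i; rewrite mulmx_vdiag mxE -mulrA vtxM eqxx.
apply/rowP => i; rewrite -dx mulmx_vdiag (yP i).2 mxE comb_vunit mulrDl !mulr_suml.
congr (_ + _).
  rewrite (bigD1 (t i)) //= big1 ?addr0 => [|v /negPf vt].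
    by rewrite -mulrA vtxM eqxx.
  by rewrite -mulrA vtxM vt mulr0.
by rewrite summxE; apply: eq_bigr => e _; rewrite !mxE mulrA.
Qed.

Lemma ghost_row_entry x i : ghost_row x -> is_gpoly (x 0 i).
Proof. by move=> [k h]; exists k. Qed.

Lemma gpoly_row_unique t c (y : edge E -> 'rV[L]_n) : (forall e, ghost_row (y e)) ->
  comb scal c (vunit t) + \sum_e gh e *: y e = 0 ->
  (forall i, c i = 0) /\ (forall e, vtx (src e) *: y e = 0).
Proof.
move=> gy h.
have hi i : (forall v, (if v == t i then c i else 0) = 0) /\
    (forall e, vtx (src e) * y e 0 i = 0).
  apply: (gpoly_unique emits) => [e|]; first exact: ghost_row_entry.
  have := congr1 (fun z : 'rV_n => z 0 i) h.
  rewrite !mxE comb_vunit summxE => hz; rewrite -[RHS]hz.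
  congr (_ + _); last first.
    by apply: eq_bigr => e _; rewrite mxE.
  rewrite (bigD1 (t i)) //= eqxx big1 ?addr0 // => v /negPf ->.
  by rewrite rmorph0 mul0r.
split=> [i|e]; first by have /(_ (t i)) := (hi i).1; rewrite eqxx.
by apply/rowP => i; rewrite !mxE (hi i).2.
Qed.

Lemma gpoly_row_unghost k (y : edge E -> 'rV[L]_n) : (forall e, ghost_row (y e)) ->
  gpoly_row k.+1 (\sum_e gh e *: y e) -> forall e, gpoly_row k (vtx (src e) *: y e).
Proof.
move=> gy h e i; rewrite mxE.
apply: (gpoly_unghost emits (y := fun e => y e 0 i)) => [f|].
  exact: ghost_row_entry.
by have := h i; rewrite summxE; under eq_bigr do rewrite mxE.
Qed.

Lemma gpoly_row_fin_spanned k :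
  fin_spanned scal (fun x : 'rV[L]_n => x = 0) (gpoly_row k).
Proof.
have k0 : kspace scal (fun x : 'rV[L]_n => x = 0).
  by split=> // c x y -> ->; rewrite scaler0 addr0.
have f2 (i : 'I_n) : fin_spanned scal (fun x : 'rV[L]_n => x = 0)
    (fun x : 'rV[L]_n => exists2 u : L^o, gpoly k u & x = (u : L) *: delta_mx 0 i).
  have flin c (x y : L^o) : ((scal c *: x + y : L^o) : L) *: delta_mx 0 i =
      scal c *: ((x : L) *: delta_mx 0 i) + (y : L) *: delta_mx 0 i :> 'rV[L]_n.
    by rewrite scalerDl scalerA.
  apply: (fin_spanned_im (f := fun x : L^o => (x : L) *: delta_mx 0 i) flin _
    (gpoly_fin_spanned K E k)).
  by move=> w ->; rewrite scale0r.
apply: fin_spanned_sub (fin_spanned_sum k0 f2) => x gx.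
exists (fun i => x 0 i *: delta_mx 0 i); split; last exact: row_sum_delta.
by move=> i; exists (x 0 i).
Qed.

End Rows.
End GhostModules.

Arguments gpoly_row_kspace {K V E n} k.
Arguments gpoly_row_fin_spanned {K V E} n k.

(** * Isomorphism classes of projective modules *)

Section MurrayVonNeumann.
Variable R : pzRingType.
Implicit Types e f : idem R.

(** Right multiplication by [X] and by [Y] are inverse isomorphisms. *)
Lemma Vcl_eqI e f (X : 'M_(idem_size e, idem_size f)) Y :
  X *m Y = idem_mx e -> Y *m X = idem_mx f -> Vcl e = Vcl f.
Proof.
move=> XY YX; apply/VclP.
have fX (x : idem_mod e) : idem_val x *m X \in @idem_fix R f.
  by rewrite unfold_in -YX mulmxA -(mulmxA _ X Y) XY idem_valK.
have fY (y : idem_mod f) : idem_val y *m Y \in @idem_fix R e.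
  by rewrite unfold_in -XY mulmxA -(mulmxA _ Y X) YX idem_valK.
apply: (@lmod_iso_build _ _ _ (fun x => IdemMod (fX x) : idem_mod f)).
  move=> a x y; apply: val_inj.
  rewrite [RHS](idem_valD (a *: (IdemMod (fX x) : idem_mod f))).
  by rewrite -[LHS]/(idem_val (a *: x + y) *m X) idem_valD mulmxDl -scalemxAl.
exists (fun y => IdemMod (fY y) : idem_mod e) => x; apply: val_inj => /=.
  by rewrite -mulmxA XY idem_valK.
by rewrite -mulmxA YX idem_valK.
Qed.

(** The rows of [X] are the images of the projections of the standard basis. *)
Lemma idem_iso_mx e f (h : {linear idem_mod e -> idem_mod f}) :
  exists X : 'M_(idem_size e, idem_size f), forall x, idem_val x *m X = idem_val (h x).
Proof.
have [pr prE] := linear_build (@idem_proj_linear R e).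
exists (\matrix_i idem_val (h (pr (delta_mx 0 i)))) => x.
have xE : x = \sum_i idem_val x 0 i *: pr (delta_mx 0 i).
  rewrite -[LHS]idem_projK -prE {1}[idem_val x]row_sum_delta linear_sum /=.
  by apply: eq_bigr => i _; rewrite linearZ.
have val0 : idem_val (0 : idem_mod f) = 0 by exact: (raddf0 val).
rewrite mulmx_sum_row {2}xE linear_sum /=.
rewrite (big_morph (@idem_val R f) (@idem_valD R f) val0).
by apply: eq_bigr => i _; rewrite rowK linearZ.
Qed.

Lemma Vcl_eqE e f : Vcl e = Vcl f ->
  exists (X : 'M_(idem_size e, idem_size f)) (Y : 'M_(idem_size f, idem_size e)),
    [/\ X *m Y = idem_mx e, Y *m X = idem_mx f,
        X *m idem_mx f = X & Y *m idem_mx e = Y].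
Proof.
move=> /VclP[h [g hK gK]].
have glin : linear g.
  by move=> a x y; apply: (can_inj hK); rewrite linearP !gK.
have [g' gE] := linear_build glin.
have [X XP] := idem_iso_mx h; have [Y YP] := idem_iso_mx g'.
have eX : idem_mx e *m X *m Y = idem_mx e.
  apply/row_matrixP => i; rewrite !row_mul !rowE.
  have := XP (idem_proj (delta_mx 0 i)); rewrite /= => ->.
  by rewrite YP gE hK.
have fY : idem_mx f *m Y *m X = idem_mx f.
  apply/row_matrixP => i; rewrite !row_mul !rowE.
  have := YP (idem_proj (delta_mx 0 i)); rewrite /= => ->.
  by rewrite XP gE gK.
have eXf : idem_mx e *m X *m idem_mx f = idem_mx e *m X.
  apply/row_matrixP => i; rewrite !row_mul !rowE.
  have := XP (idem_proj (delta_mx 0 i)); rewrite /= => ->.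
  exact: idem_valK.
have fYe : idem_mx f *m Y *m idem_mx e = idem_mx f *m Y.
  apply/row_matrixP => i; rewrite !row_mul !rowE.
  have := YP (idem_proj (delta_mx 0 i)); rewrite /= => ->.
  exact: idem_valK.
exists (idem_mx e *m X), (idem_mx f *m Y); split=> //.
  by rewrite mulmxA eXf.
by rewrite mulmxA fYe.
Qed.

Lemma VclD e f : Vcl (idem_dsum e f) = Vcl e + Vcl f.
Proof. by rewrite -VaddE. Qed.

End MurrayVonNeumann.

Section VertexModules.
Variables (K : fieldType) (V : finType) (E : digraph V).

Local Notation L := (LPA K E).
Local Notation vtx := (lpa_vertex K E).
Local Notation eg := (@lpa_edge K V E).
Local Notation gh := (@lpa_ghost K V E).

(** The direct sum of the projective modules [L (t i)]. *)
Definition videm n (t : 'I_n -> V) : idem L := Idem (@vdiag_idem K V E n t).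

Definition vtx_Vcl (v : V) : Vmon L := Vcl (videm (fun _ : 'I_1 => v)).

Lemma vdiag_block m n (t : 'I_(m + n) -> V) :
  vdiag K E t = block_mx (vdiag K E (t \o lshift n)) 0 0 (vdiag K E (t \o @rshift m n)).
Proof.
rewrite /vdiag -diag_mx_row; congr diag_mx; apply/rowP => i.
by rewrite !mxE; case: splitP => j ij; rewrite mxE; congr (vtx (t _)); apply: val_inj.
Qed.

Lemma Vcl_videm_add m n (t : 'I_(m + n) -> V) :
  Vcl (videm t) = Vcl (videm (t \o lshift n)) + Vcl (videm (t \o @rshift m n)).
Proof.
pose d := idem_dsum (videm (t \o lshift n)) (videm (t \o @rshift m n)).
rewrite -VclD; apply: (@Vcl_eqI _ (videm t) d (vdiag K E t) (vdiag K E t)).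
  exact: vdiag_idem.
by rewrite /= -vdiag_block; apply: vdiag_idem.
Qed.

Lemma Vcl_videm n (t : 'I_n -> V) : Vcl (videm t) = \sum_i vtx_Vcl (t i).
Proof.
elim: n t => [|n IHn] t.
  rewrite big_ord0; apply: (@Vcl_eqI _ (videm t) (idem0 L) 0 0).
    by rewrite mul0mx [RHS]flatmx0.
  by rewrite mul0mx.
rewrite (@Vcl_videm_add 1 n t) IHn big_ord_recl; congr (_ + _).
  by congr Vcl; congr videm; apply: funext => i /=; congr t; apply: val_inj; case: i => -[].
by apply: eq_bigr => i _ /=; congr (vtx_Vcl (t _)); apply: val_inj.
Qed.

(** The edges leaving [v] and the corresponding ghosts are the entries of the
   two matrices, whose products are given by (CK2) and (CK1). *)
Lemma vtx_Vcl_CK2 (e0 : edge E) :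
  vtx_Vcl (src e0) = \sum_(e : edge E | src e == src e0) vtx_Vcl (tgt e).
Proof.
pose A := [pred e : edge E | src e == src e0].
pose t (i : 'I_#|A|) := tgt (enum_val i).
transitivity (Vcl (videm t)); last first.
  by rewrite Vcl_videm -(big_enum_val (A := A) (fun e => vtx_Vcl (tgt e))).
apply: (@Vcl_eqI _ (videm (fun _ : 'I_1 => src e0)) (videm t)
  (\row_i eg (enum_val i)) (\col_i gh (enum_val i))).
  apply/matrixP => i j; rewrite !ord1 !mxE /= mulr1n vtx_CK2.
  rewrite (big_enum_val (A := A) (fun e => eg e * gh e)).
  by apply: eq_bigr => k _; rewrite !mxE.
apply/matrixP => i j; rewrite !mxE big_ord1 !mxE ghost_edge (inj_eq enum_val_inj).
by case: eqP => [->|_].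
Qed.

End VertexModules.

(** * Resolutions by vertex modules *)

Section Resolution.
Variables (K : fieldType) (V : finType) (E : digraph V).
Hypothesis emits : forall v, exists e : edge E, src e = v.

Local Notation L := (LPA K E).
Local Notation vtx := (lpa_vertex K E).
Local Notation eg := (@lpa_edge K V E).
Local Notation gh := (@lpa_ghost K V E).
Local Notation scal := (@scal K V E).
Local Notation vdiag := (@vdiag K V E _).

Lemma vtx_expand (P : lmodType L) (x : P) : x = \sum_v vtx v *: x.
Proof. by rewrite -scaler_suml -lpa_1E scale1r. Qed.

(** There are finitely many ghost paths of length [m], so one [k] suits all of
   them. *)
Lemma after_uniform (P : lmodType L) (Q : nat -> P -> Prop) m x :
  (forall k k' x, (k <= k')%N -> Q k x -> Q k' x) ->
  after_ghosts (fun x => exists k, Q k x) m x -> exists k, after_ghosts (Q k) m x.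
Proof.
move=> Qle; elim: m x => [|m IHm] x //= h.
have [k kP] := choice (fun e => IHm _ (h e)).
exists (\max_e k e)%N => e; apply: after_imp (kP e) => y.
by apply: Qle; apply: leq_bigmax.
Qed.

Definition scalar_row n (c : 'I_n -> K) : 'rV[L]_n := \row_i scal (c i).

Lemma scalar_row_mul n m (c : 'I_n -> K) (A : 'M[L]_(n, m)) :
  scalar_row c *m A = comb scal c (fun i => row i A).
Proof. by rewrite mulmx_sum_row; apply: eq_bigr => i _; rewrite mxE. Qed.

Variables (N : nat) (eps : 'M[L]_N).
Hypothesis epsK : eps *m eps = eps.

(** The vectors of the module [L^N eps] with entries of length less than [k], a
   finite-dimensional space. *)
Definition bounded_part k (x : 'rV[L]_N) := gpoly_row k x /\ x *m eps = x.

Lemma bounded_part_le k k' x : (k <= k')%N -> bounded_part k x -> bounded_part k' x.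
Proof. by move=> kk [gx ex]; split=> //; apply: gpoly_row_le gx. Qed.

Lemma bounded_part_kspace k : kspace scal (bounded_part k).
Proof.
split=> [|c x y [gx ex] [gy ey]].
  by split; [apply: kspace0; apply: gpoly_row_kspace|rewrite mul0mx].
split; first by apply: (gpoly_row_kspace k).2.
by rewrite mulmxDl -scalemxAl ex ey.
Qed.

Lemma bounded_part_vtx k v x : bounded_part k x -> bounded_part k (vtx v *: x).
Proof. by move=> [gx ex]; split; [apply: gpoly_row_vtx|rewrite -scalemxAl ex]. Qed.

Lemma bounded_part_ghost k e x : bounded_part k x -> bounded_part k.+1 (gh e *: x).
Proof. by move=> [gx ex]; split; [apply: gpoly_row_ghost|rewrite -scalemxAl ex]. Qed.

Lemma bounded_part_generates :
  exists d, forall i, exists m, after_ghosts (bounded_part d) m (row i eps).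
Proof.
have h i : exists k m, after_ghosts (bounded_part k) m (row i eps).
  have [m hm] := ghost_row_eventually (row i eps).
  have re : row i eps *m eps = row i eps by rewrite -row_mul epsK.
  have /(after_uniform bounded_part_le)[k hk] :
      after_ghosts (fun x => exists k, bounded_part k x) m (row i eps).
    have := @after_and _ _ _ _ _ (fun x => x *m eps = x) m _ _ re hm.
    move=> /(_ (fun e x ex => fixed_ghost (gh e) ex)).
    by apply: after_imp => x [[k gx] ex]; exists k.
  by exists k, m.
have [k kP] := choice h.
exists (\max_i k i)%N => i; have [m hm] := kP i; exists m.
by apply: after_imp hm => x; apply: bounded_part_le; apply: leq_bigmax.
Qed.

Definition bounded_part_homog k x := bounded_part k x /\ exists v, vtx v *: x = x.

(** Every [x] is the sum of the [v x], so the vectors fixed by a vertex span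
   and a basis can be chosen among them. *)
Lemma homog_basis (W : 'rV[L]_N -> Prop) k : kspace scal W ->
  exists n (x : 'I_n -> 'rV[L]_N) (t : 'I_n -> V),
    basis_mod scal W x (bounded_part k) /\ forall i, vtx (t i) *: x i = x i.
Proof.
move=> kW.
have [J [y yS]] := @gpoly_row_fin_spanned K V E N k.
have yS' : spans_mod scal W y (bounded_part_homog k).
  by move=> u [[gu _] _]; have [c /= uE] := yS _ gu; exists c; rewrite uE; apply: kspace0 kW.
have [n [x [xH xI xS]]] := basis_exists kW yS'.
have [t tP] := choice (fun i => (xH i).2).
exists n, x, t; split=> //; split=> // [i|u wu]; first exact: (xH i).1.
rewrite [u]vtx_expand; apply: (spans_mod_sum kW xS) => v.
split; first exact: bounded_part_vtx.
by exists v; rewrite scalerA vtxM eqxx.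
Qed.

(** The setting is that of a basis [u] of the vectors of length less than [d],
   completed by [w'] to a basis [w] of those of length less than [d.+1]. *)
Section Presentation.
Variables (d c b : nat) (u : 'M[L]_(c, N)) (w' : 'M[L]_(b, N)).
Variables (s : 'I_c -> V) (t : 'I_(c + b) -> V).
Let w := col_mx u w'.
Hypothesis ts : t \o lshift b = s.
Hypothesis w_homog : vdiag t *m w = w.
Hypothesis w_bounded : forall i, bounded_part d.+1 (row i w).
Hypothesis w_indep : forall g, scalar_row g *m w = 0 -> forall i, g i = 0.
Hypothesis w_spans : forall x, bounded_part d.+1 x -> exists g, x = scalar_row g *m w.
Hypothesis u_spans : forall x, bounded_part d x -> exists g, x = scalar_row g *m u.
Hypothesis generates : forall i, exists m, after_ghosts (bounded_part d.+1) m (row i eps).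
Variable G : edge E -> 'I_c -> 'I_(c + b) -> K.
Hypothesis GP : forall e i, gh e *: row i u = scalar_row (G e i) *m w.

Let Gm e : 'M[L]_(c, c + b) := \matrix_(i, j) scal (G e i j).

(** The relations [u_i = \sum_e e (e^* u_i)], the vectors [e^* u_i] being
   expressed through the generators [w]. *)
Definition relmx : 'M[L]_(c, c + b) :=
  vdiag s *m (row_mx 1%:M 0 - \sum_e eg e *: Gm e) *m vdiag t.

Let vdiagK n (r : 'I_n -> V) : vdiag r *m vdiag r = vdiag r.
Proof. exact: vdiag_idem. Qed.

Lemma relmx_idl : vdiag s *m relmx = relmx.
Proof. by rewrite /relmx !mulmxA vdiagK. Qed.

Lemma relmx_idr : relmx *m vdiag t = relmx.
Proof. by rewrite /relmx -mulmxA vdiagK. Qed.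

Lemma relmx_w : relmx *m w = 0.
Proof.
rewrite /relmx -mulmxA w_homog -mulmxA mulmxBl mul_row_col mul1mx mul0mx addr0.
rewrite mulmx_suml (_ : \sum_e _ = u) ?subrr ?mulmx0 //.
rewrite [RHS](edge_ghost_expand emits); apply: eq_bigr => e _.
rewrite -scalemxAl; congr (_ *: _); apply/row_matrixP => i.
rewrite row_mul linearZ /= GP; congr (_ *m _).
by apply/rowP => j; rewrite !mxE.
Qed.

Lemma vdiag_s_row : row_mx (vdiag s) 0 *m vdiag t = row_mx (vdiag s) 0.
Proof. by rewrite vdiag_block ts mul_row_block vdiagK !mulmx0 mul0mx !addr0. Qed.

Lemma vdiag_s_u : vdiag s *m u = u.
Proof.
have : row_mx 1%:M 0 *m (vdiag t *m w) = row_mx 1%:M 0 *m w by rewrite w_homog.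
rewrite vdiag_block ts mul_block_col mul0mx addr0 !mul_row_col !mul1mx !mul0mx !addr0.
by [].
Qed.

Lemma relmx_split :
  row_mx (vdiag s) 0 - relmx = vdiag s *m (\sum_e eg e *: Gm e) *m vdiag t.
Proof.
rewrite /relmx mulmxBr mulmxBl mul_mx_row mulmx1 mulmx0 vdiag_s_row.
by rewrite opprB addrC subrK.
Qed.

(** In [e^* s_i f] the edge [f] either cancels against [e^*] or gives [0]. *)
Lemma gpoly_row_relmx_split e (g : 'I_c -> K) :
  gpoly_row 1 (gh e *: (scalar_row g *m (row_mx (vdiag s) 0 - relmx))).
Proof.
rewrite relmx_split mulmx_sumr mulmx_suml mulmx_sumr scaler_sumr => j.
rewrite summxE; apply: gpoly_sum => f _.
rewrite mulmxA mxE mulmx_vdiag mulrA; apply: gpoly_mul_vtx.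
rewrite mulmxA mxE mulr_sumr; apply: gpoly_sum => i _.
rewrite mulmx_vdiag !mxE scal_mul mul_scal -lpa_scalerAl -!lpa_scalerAr.
rewrite -[X in gpoly _ X]scal_mul. apply: gpolyZ.
rewrite -[X in gpoly _ X]scal_mul; apply: gpolyZ; rewrite mulrA.
exact/gpoly_ghost_edge/gpoly_vtx.
Qed.

Lemma comb_vunit_w (g : 'I_(c + b) -> K) :
  comb scal g (vunit K E t) *m w = scalar_row g *m w.
Proof.
rewrite -[in RHS]w_homog mulmxA; congr (_ *m _); apply/rowP => i.
by rewrite comb_vunit mulmx_vdiag mxE.
Qed.

(** A constant row in the kernel is a linear relation between the vectors of
   the basis [w]. *)
Lemma constant_kernel (x : 'rV[L]_(c + b)) :
  gpoly_row 1 x -> x *m vdiag t = x -> x *m w = 0 -> x = 0.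
Proof.
move=> gx dx; have [g [y [yP ->]]] := gpoly_row_rec gx dx.
have -> : \sum_e gh e *: y e = 0.
  apply: big1 => e _; rewrite (_ : y e = 0) ?scaler0 //.
  by apply/rowP => i; rewrite mxE; apply: (yP e).1.
rewrite addr0 comb_vunit_w => /w_indep g0; apply: big1 => i _.
by rewrite g0 rmorph0 scale0r.
Qed.

Definition relspace (x : 'rV[L]_(c + b)) := exists y, x = y *m relmx.

Lemma relspace_submodule : submodule relspace.
Proof.
split=> [|x x' [y ->] [y' ->]|r x [y ->]]; first by exists 0; rewrite mul0mx.
  by exists (y + y'); rewrite mulmxDl.
by exists (r *: y); rewrite scalemxAl.
Qed.

Lemma scalar_row_gpoly1 n (g : 'I_n -> K) (r : 'I_n -> V) :
  gpoly_row 1 (scalar_row g *m vdiag r).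
Proof. by move=> i; rewrite mulmx_vdiag mxE; apply/gpolyZ/gpoly_vtx. Qed.

(** Writing [x = x_0 + \sum_e e^* y_e] with [x_0] constant, the leading terms
   show that [y_e w] lies in the span of [u]: up to a constant combination of
   the rows [(s_i, 0)], [y_e] is in the kernel, hence in the row space of
   [relmx] by induction.  Modulo this row space [e^* (s_i, 0)] is constant, so
   [x] is congruent to a constant row in the kernel, which must be [0]. *)
Lemma lattice_kernel k (x : 'rV[L]_(c + b)) :
  gpoly_row k.+1 x -> x *m vdiag t = x -> x *m w = 0 -> relspace x.
Proof.
have [S0 SD SZ] := relspace_submodule.
elim: k x => [|k IHk] x gx dx xw.
  by rewrite (constant_kernel gx dx xw).
(* [\sum_e e^* (y_e w)] is minus the constant part of [x] times [w], which
   bounds its length and therefore that of the [y_e w] *)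
have [g [y [yP xE]]] := gpoly_row_rec gx dx.
have yw : \sum_e gh e *: (y e *m w) = - (scalar_row g *m w).
  apply/eqP; rewrite -addr_eq0 addrC -comb_vunit_w -[X in _ == X]xw xE mulmxDl.
  by apply/eqP; congr (_ + _); rewrite mulmx_suml; apply: eq_bigr => e _; rewrite -scalemxAl.
have gw : bounded_part d.+1 (scalar_row g *m w).
  by rewrite scalar_row_mul; apply: kspace_comb => //; apply: bounded_part_kspace.
have zP e : exists z, vtx (src e) *: (y e *m w) = scalar_row z *m u.
  apply: u_spans; split; last first.
    rewrite -scalemxAl -mulmxA; congr (_ *: (_ *m _)).
    by apply/row_matrixP => i; rewrite row_mul; apply: (w_bounded i).2.
  apply: (gpoly_row_unghost emits (y := fun e => y e *m w)) => [f|].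
    exists (k.+1 + d.+1)%N => i; rewrite mxE; apply: gpoly_sum => j _.
    apply: gpolyM; first exact: (yP f).1.
    by have := (w_bounded j).1 i; rewrite mxE.
  by rewrite yw; apply: (kspaceN (gpoly_row_kspace _)) => //; apply: gw.1.
have [z {}zP] := choice zP.
pose r e := vtx (src e) *: y e - scalar_row (z e) *m row_mx (vdiag s) 0.
have rS e : relspace (r e).
  apply: IHk.
  - apply: (kspaceB (gpoly_row_kspace _)); first by apply: gpoly_row_vtx; apply: (yP e).1.
    rewrite mul_mx_row mulmx0 => i; rewrite mxE; case: splitP => j _.
      by apply: gpoly_le (scalar_row_gpoly1 _ _ _).
    by rewrite mxE; apply: gpoly0.
  - by rewrite mulmxBl -scalemxAl (yP e).2 -mulmxA vdiag_s_row.
  - rewrite mulmxBl -scalemxAl zP -mulmxA mul_row_col mul0mx addr0 vdiag_s_u.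
    by rewrite subrr.
(* the constant row congruent to [x] *)
pose x' := x - \sum_e gh e *: r e - \sum_e gh e *: (scalar_row (z e) *m relmx).
have -> : x = x' + (\sum_e gh e *: r e + \sum_e gh e *: (scalar_row (z e) *m relmx)).
  by rewrite /x' addrA [X in X + _]addrAC subrK subrK.
apply: (SD); last first.
  apply: SD; apply: (submodule_sum _ relspace_submodule) => e; apply: SZ => //.
  by exists (scalar_row (z e)).
have rd e : r e *m vdiag t = r e.
  by rewrite mulmxBl -scalemxAl (yP e).2 -mulmxA vdiag_s_row.
rewrite (@constant_kernel x') //.
- rewrite /x' {1}xE -!addrA -opprD -big_split -sumrB.
  apply: (kspaceD (gpoly_row_kspace _)).
    by apply: (kspace_comb (gpoly_row_kspace _)) => i; apply: vunit_grow.
  apply: (kspace_sum (gpoly_row_kspace _)) => e _; rewrite /= -scalerDr -scalerBr.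
  have -> : gh e *: (y e - (r e + scalar_row (z e) *m relmx)) =
            gh e *: (scalar_row (z e) *m (row_mx (vdiag s) 0 - relmx)).
    rewrite /r scalerBr scalerDr scalerBr scalerA ghost_vtx eqxx mulmxBr scalerBr.
    by rewrite opprD opprB addrA addrCA subrr addr0.
  exact: gpoly_row_relmx_split.
- rewrite /x' !mulmxBl dx !mulmx_suml; congr (_ - _ - _).
    by apply: eq_bigr => e _; rewrite -scalemxAl rd.
  by apply: eq_bigr => e _; rewrite -scalemxAl -mulmxA relmx_idr.
rewrite /x' !mulmxBl xw sub0r !mulmx_suml !big1 ?oppr0 ?addr0 // => e _.
  by rewrite -scalemxAl -mulmxA relmx_w mulmx0 scaler0.
rewrite -scalemxAl mulmxBl -scalemxAl zP -mulmxA mul_row_col mul0mx addr0 vdiag_s_u.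
by rewrite subrr scaler0.
Qed.

Lemma kernel_relspace (x : 'rV[L]_(c + b)) :
  x *m vdiag t = x -> x *m w = 0 -> relspace x.
Proof.
move=> dx xw; have [m hm] := lattice_eventually dx.
apply: (after_submodule emits relspace_submodule (m := m)).
have := @after_and _ _ _ _ _ (fun x => x *m w = 0) m x _ xw hm.
move=> /(_ (fun e x ex => etrans (fixed_ghost (gh e) ex) (scaler0 _ _))).
apply: after_imp => {dx xw hm} x [[[k gx] dx] xw].
by apply: (lattice_kernel (k := k)) => //; apply: gpoly_row_le gx.
Qed.

(** If [y] is in the kernel of [relmx], then it is a combination of the [y e].
   In [e'^* y e] the edge [e] removes a letter from each ghost path, so this
   has the length of [y], one less than expected of [e'^* y]. *)
Lemma lattice_relmx_inj k (y : 'rV[L]_c) :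
  gpoly_row k y -> y *m vdiag s = y -> y *m relmx = 0 -> y = 0.
Proof.
elim: k y => [|k IHk] y gy dy yB; first by apply/rowP => i; rewrite mxE; apply: gy.
apply: IHk => // i.
have ghy e : gpoly k.+1 (gh e * y 0 i).
  have yE : row_mx y 0 = y *m (\sum_e eg e *: Gm e) *m vdiag t.
    have := congr1 (mulmx y) relmx_split.
    rewrite mulmxBr yB subr0 mul_mx_row mulmx0 dy => ->.
    by rewrite !mulmxA dy.
  have -> : y 0 i = row_mx y (0 : 'rV_b) 0 (lshift b i) by rewrite row_mxEl.
  rewrite yE mulmx_vdiag mulrA; apply: gpoly_mul_vtx.
  rewrite mxE mulr_sumr; apply: gpoly_sum => j _; rewrite summxE !mulr_sumr.
  apply: gpoly_sum => f _; rewrite !mxE mul_scal -!lpa_scalerAr -[X in gpoly _ X]scal_mul.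
  by apply: gpolyZ; rewrite mulrA; apply/gpoly_ghost_edge/gy.
rewrite -[y 0 i]mul1r lpa_1E mulr_suml; apply: gpoly_sum => v _.
have [e <-] := emits v; apply: gpoly_unghost1 => //; by exists k.+1.
Qed.

Lemma relmx_inj (y : 'rV[L]_c) : y *m vdiag s = y -> y *m relmx = 0 -> y = 0.
Proof.
move=> dy yB; have [m hm] := lattice_eventually dy.
have s0 : submodule (fun y : 'rV[L]_c => y = 0).
  by split=> // [x x' -> ->|r x ->]; rewrite ?addr0 ?scaler0.
apply: (after_submodule emits s0 (m := m)).
have := @after_and _ _ _ _ _ (fun x => x *m relmx = 0) m y _ yB hm.
move=> /(_ (fun e x ex => etrans (fixed_ghost (gh e) ex) (scaler0 _ _))).
apply: after_imp => {dy yB hm} x [[[k gx] dx] xw].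
exact: lattice_relmx_inj gx dx xw.
Qed.

Lemma eps_rows : exists S : 'M[L]_(N, c + b), eps = S *m w.
Proof.
have sS : submodule (fun x : 'rV[L]_N => exists y, x = y *m w).
  split=> [|x x' [y ->] [y' ->]|r x [y ->]]; first by exists 0; rewrite mul0mx.
    by exists (y + y'); rewrite mulmxDl.
  by exists (r *: y); rewrite scalemxAl.
have h i : exists y, row i eps = y *m w.
  have [m hm] := generates i; apply: (after_submodule emits sS (m := m)).
  by apply: after_imp hm => x /w_spans[g ->]; exists (scalar_row g).
have [S SE] := choice h; exists (\matrix_i S i).
by apply/row_matrixP => i; rewrite row_mul rowK.
Qed.

(** The exact sequence [0 -> L^s -> L^t -> L^N eps -> 0] given by [relmx] and
   [w] splits. *)
Lemma resolution_split : Vcl (Idem epsK) + Vcl (videm K E s) = Vcl (videm K E t).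
Proof.
have w_eps : w *m eps = w.
  by apply/row_matrixP => i; rewrite row_mul; apply: (w_bounded i).2.
have [S0 S0E] := eps_rows; pose S := eps *m S0 *m vdiag t.
have Sw : S *m w = eps by rewrite /S -!mulmxA w_homog -S0E epsK.
have eS : eps *m S = S by rewrite /S !mulmxA epsK.
have Sd : S *m vdiag t = S by rewrite /S -mulmxA vdiagK.
have h i : exists y, row i (vdiag t - w *m S) = y *m relmx.
  apply: kernel_relspace; rewrite -row_mul mulmxBl.
    by rewrite vdiagK -mulmxA Sd.
  by rewrite -mulmxA Sw w_homog w_eps subrr row0.
have [C0 C0E] := choice h; pose C := (\matrix_i C0 i) *m vdiag s.
have CB : C *m relmx = vdiag t - w *m S.
  apply/row_matrixP => i; rewrite row_mul C0E /C row_mul rowK -mulmxA.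
  by rewrite relmx_idl.
have Cd : C *m vdiag s = C by rewrite /C -mulmxA vdiagK.
have inj m (Z : 'M_(m, c)) : Z *m vdiag s = Z -> Z *m relmx = 0 -> Z = 0.
  move=> Zd ZB; apply/row_matrixP => i; rewrite row0; apply: relmx_inj.
    by rewrite -row_mul Zd.
  by rewrite -row_mul ZB row0.
have BC : relmx *m C = vdiag s.
  apply/eqP; rewrite -subr_eq0; apply/eqP/inj.
    by rewrite mulmxBl -mulmxA Cd vdiagK.
  rewrite mulmxBl -mulmxA CB mulmxBr relmx_idr relmx_idl mulmxA relmx_w mul0mx.
  by rewrite subr0 subrr.
have SC : S *m C = 0.
  apply: inj; first by rewrite -mulmxA Cd.
  by rewrite -mulmxA CB mulmxBr Sd mulmxA Sw eS subrr.
rewrite -VclD; pose e' := idem_dsum (Idem epsK) (videm K E s).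
apply: (@Vcl_eqI _ e' (videm K E t) (col_mx S relmx) (row_mx w C)).
  by rewrite mul_col_row Sw SC relmx_w BC.
by rewrite mul_row_col CB addrC subrK.
Qed.

End Presentation.

(** For [d] large enough that the vectors of length less than [d] generate
   [L^N eps], the relations [u_i = \sum_e e (e^* u_i)] present this module and
   are independent. *)
Theorem vertex_resolution : exists (m n : nat) (s : 'I_m -> V) (t : 'I_n -> V),
  Vcl (Idem epsK) + Vcl (videm K E s) = Vcl (videm K E t).
Proof.
have [d0 gen0] := bounded_part_generates.
have gen i : exists m, after_ghosts (bounded_part d0.+1) m (row i eps).
  by have [m hm] := gen0 i; exists m; apply: after_imp hm => x; apply: bounded_part_le.
have z0 : kspace scal (fun x : 'rV[L]_N => x = 0).
  by split=> // c x y -> ->; rewrite scaler0 addr0.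
have [c [u [s [uB us]]]] := homog_basis d0 z0.
have [b [w' [s' [wB ws]]]] := homog_basis d0.+1 (bounded_part_kspace d0).
have jB : basis_mod scal (fun x : 'rV[L]_N => x = 0) (join_fam u w') (bounded_part d0.+1).
  apply: basis_mod_tower wB uB; first exact: bounded_part_kspace.
    by move=> _ ->; apply: kspace0; apply: bounded_part_kspace.
  by move=> w; apply: bounded_part_le.
pose U := \matrix_i u i; pose W := \matrix_i w' i.
pose t i := match split i with inl i => s i | inr j => s' j end.
have joinE i : row i (col_mx U W) = join_fam u w' (split i).
  apply/rowP => j; rewrite !mxE; case: splitP => k _ /=; by rewrite mxE.
have scalar_rowE g : scalar_row g *m col_mx U W =
    comb scal (g \o @unsplit c b) (join_fam u w').
  rewrite scalar_row_mul (comb_reindex _ _ (h := @unsplit c b)); last first.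
    by exists (@split c b); [apply: unsplitK|apply: splitK].
  by congr comb; apply: funext => i /=; rewrite joinE unsplitK.
have [jU jI jS] := jB.
have spanW x : bounded_part d0.+1 x -> exists g, x = scalar_row g *m col_mx U W.
  move=> /jS[g /subr0_eq ->]; exists (g \o @split c b); rewrite scalar_rowE.
  by congr comb; apply: funext => i /=; rewrite unsplitK.
have hG (p : edge E * 'I_c) : exists g, gh p.1 *: row p.2 U = scalar_row g *m col_mx U W.
  apply: spanW; rewrite rowK; apply: bounded_part_ghost; case: uB => uU _ _; exact: uU.
have [G GP] := choice hG.
exists c, (c + b)%N, s, t.
apply: (@resolution_split d0 c b U W s t _ _ _ _ _ _ gen (fun e i => G (e, i))) => //.
- by apply: funext => i; rewrite /t /= (unsplitK (inl i)).
- apply/row_matrixP => i; rewrite row_mul row_diag_mx -scalemxAl -rowE mxE joinE.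
  by rewrite /t; case: (split i) => j /=.
- by move=> i; rewrite joinE.
- move=> g; rewrite scalar_rowE => /jI h i; have := h (split i).
  by rewrite /= splitK.
- move=> x; case: uB => _ _ uS /uS[g /subr0_eq ->]; exists g.
  by rewrite scalar_row_mul; congr comb; apply: funext => i; rewrite rowK.
by move=> e i; apply: (GP (e, i)).
Qed.

End Resolution.

(** * The index of an isomorphism of vertex modules *)

Section LatticeIndex.
Variables (K : fieldType) (V : finType) (E : digraph V).
Hypothesis emits : forall v, exists e : edge E, src e = v.

Local Notation L := (LPA K E).
Local Notation vtx := (lpa_vertex K E).
Local Notation gh := (@lpa_ghost K V E).
Local Notation scal := (@scal K V E).
Local Notation vdiag := (@vdiag K V E _).

Definition vcount n (t : 'I_n -> V) (w : V) : nat := #|[pred i | t i == w]|.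

Section GhostClosed.
Variables (P : lmodType L) (I : P -> Prop) (gI : ghost_closed I).

Let kI : kspace scal I. Proof. by case: gI. Qed.

Lemma ghost_closed_gpoly k a x : gpoly k a -> I x -> I (a *: x).
Proof.
case: (gI) => _ Iv Ig; elim: k a => [|k IHk] a.
  by move=> -> _; rewrite scale0r; apply: kspace0 kI.
move=> [c [y [yk ->]]] Ix; rewrite scalerDl !scaler_suml; apply: (kspaceD kI).
  by apply: (kspace_sum kI) => v _; rewrite -scalerA; apply/(kspaceZ kI)/Iv.
by apply: (kspace_sum kI) => e _; rewrite -scalerA; apply/Ig/IHk => //; apply: yk.
Qed.

(** A ghost polynomial is a combination of finitely many ghost paths of length
   less than [m] modulo multiples of those of length [m]. *)
Lemma fin_spanned_after m x : after_ghosts I m x ->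
  fin_spanned scal I (fun y => exists a, is_gpoly a /\ y = a *: x).
Proof.
elim: m x => [|m IHm] x hx.
  by apply: fin_spanned_mod => // y [a [[k ak] ->]]; apply: ghost_closed_gpoly ak _.
have f1 := fin_spanned_sum kI (fun v => fin_spanned_line (vtx v *: x) kI).
have f2 := fin_spanned_sum kI (fun e => IHm _ (hx e)).
apply: fin_spanned_sub (fin_spanned_add kI f1 f2) => y [a [[k /gpolyS ak] ->]].
have [c [b [bk ->]]] := gpoly_recr ak.
rewrite scalerDl !scaler_suml.
exists (\sum_v scal (c v) *: (vtx v *: x)), (\sum_e b e *: (gh e *: x)); split.
- by exists (fun v => scal (c v) *: (vtx v *: x)); split=> // v; exists (c v).
- exists (fun e => b e *: (gh e *: x)); split=> // e; exists (b e); split=> //.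
  by exists k.
by congr (_ + _); apply: eq_bigr => i _; rewrite scalerA.
Qed.

Definition vpart (v : V) (Q : P -> Prop) (x : P) := Q x /\ vtx v *: x = x.

(** The part at [w] of the vectors of [I] that begin with a ghost edge. *)
Definition ghost_image (w : V) (x : P) := exists z : edge E -> P,
  (forall e, I (z e)) /\ x = \sum_(e | tgt e == w) gh e *: z e.

Lemma vpart_kspace v : kspace scal (vpart v I).
Proof.
split=> [|c x y [Ix vx] [Iy vy]]; first by split; [apply: kspace0 kI|rewrite scaler0].
by split; [apply: kI.2|rewrite scalerDr -scalZC vx vy].
Qed.

Lemma ghost_image_kspace w : kspace scal (ghost_image w).
Proof.
split=> [|c x y [z [Iz ->]] [z' [Iz' ->]]].
  exists (fun=> 0); split=> [_|]; first exact: kspace0 kI.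
  by rewrite big1 // => e _; rewrite scaler0.
exists (fun e => scal c *: z e + z' e); split=> [e|]; first exact: kI.2.
rewrite scaler_sumr -big_split; apply: eq_bigr => e _ /=.
by rewrite scalerDr scalZC.
Qed.

Lemma ghost_image_sub w x : ghost_image w x -> vpart w I x.
Proof.
case: gI => _ _ Ig [z [Iz ->]]; split.
  by apply: (kspace_sum kI) => e _; apply: Ig.
rewrite scaler_sumr; apply: eq_bigr => e /eqP <-.
by rewrite scalerA vtx_ghost eqxx.
Qed.

End GhostClosed.

Lemma has_codim_ord (M : lmodType L) (U W : M -> Prop) d : kspace scal W ->
  has_codim scal U W d -> exists x : 'I_d -> M, basis_mod scal W x U.
Proof.
move=> kW h; have [J [y [_ [_ _ yS]]]] := h.
have [d' [x xB]] := basis_exists kW yS.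
suff dd : d = d' by subst d'; exists x.
by apply: (has_codim_uniq kW h); exists 'I_d', x; rewrite card_ord.
Qed.

Section OneLattice.
Variables (n : nat) (t : 'I_n -> V) (I : 'rV[L]_n -> Prop).
Hypotheses (gI : ghost_closed I) (IL : forall x, I x -> lattice t x).

Let kI : kspace scal I. Proof. by case: gI. Qed.

(** Since ghost paths are independent, the part of the lattice at [w] is the
   direct sum of the lines of the generators at [w] and of the [e^* s(e) Q],
   where [Q] is the lattice and [e] ends at [w]. *)
Lemma lattice_codim (d : V -> nat) w :
  (forall v, has_codim scal (vpart v (lattice t)) I (d v)) ->
  has_codim scal (vpart w (lattice t)) (ghost_image I w)
    (vcount t w + \sum_(e : edge E | tgt e == w) d (src e)).
Proof.
move=> hd.
(* edges that do not end at [w] get an empty basis, so that the index type of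
   the family [fam] needs no subtypes *)
pose D (e : edge E) := if tgt e == w then d (src e) else 0%N.
have hx e : exists x : 'I_(D e) -> 'rV[L]_n,
    tgt e = w -> basis_mod scal I x (vpart (src e) (lattice t)).
  have [x xB] := has_codim_ord kI (hd (src e)).
  by rewrite /D; case: eqP => [_|ew]; [exists x|exists (fun=> 0) => /ew].
have x_ e := cid (hx e); pose x e := sval (x_ e).
have {hx}xB e : tgt e = w -> basis_mod scal I (x e) (vpart (src e) (lattice t)).
  exact: svalP (x_ e).
pose J := ({i : 'I_n & 'I_(t i == w)} + {e : edge E & 'I_(D e)})%type.
pose jV i (j : 'I_(t i == w)) : J := inl (existT (fun i => 'I_(t i == w)) i j).
pose jE e (j : 'I_(D e)) : J := inr (existT (fun e => 'I_(D e)) e j).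
pose fam (j : J) : 'rV[L]_n := match j with
  | inl i => vunit K E t (tag i)
  | inr p => gh (tag p) *: x (tag p) (tagged p) end.
have combE c : comb scal c fam =
    comb scal (fun i => \sum_(j < (t i == w)) c (jV i j)) (vunit K E t) +
    \sum_e gh e *: comb scal (fun j => c (jE e j)) (x e).
  rewrite comb_sum; congr (_ + _).
    rewrite /comb; under [RHS]eq_bigr do rewrite rmorph_sum scaler_suml.
    rewrite (sig_big_dep predT (fun _ => predT) (fun i (j : 'I_(t i == w)) =>
      scal (c (jV i j)) *: vunit K E t i)) /=.
    by apply: eq_bigr => -[i j] _.
  rewrite /comb; under [RHS]eq_bigr do rewrite scaler_sumr.
  rewrite (sig_big_dep predT (fun _ => predT) (fun e (j : 'I_(D e)) =>
    gh e *: (scal (c (jE e j)) *: x e j))) /=.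
  by apply: eq_bigr => -[e j] _ /=; rewrite scalZC.
have jD e (j : 'I_(D e)) : tgt e = w.
  have : (0 < D e)%N by apply: leq_ltn_trans (ltn_ord j).
  by rewrite /D; case: eqP.
have xD e : tgt e <> w -> forall c, comb scal c (x e) = 0.
  by move=> ew c; apply: big1 => j; have /ew := jD _ j.
exists J, fam; split.
  rewrite card_sum !card_tagged !sumnE !big_map -!enumT !big_enum /=; congr (_ + _)%N.
    rewrite /vcount -sum1_card [RHS]big_mkcond.
    by apply: eq_bigr => i _; rewrite card_ord inE; case: eqP.
  by rewrite [RHS]big_mkcond; apply: eq_bigr => e _; rewrite card_ord.
have [[k0 kD] Lv Lg] := @lattice_closed K V E n t.
split.
- case=> [[i j]|[e j]] /=.
    have /eqP <- : t i == w by case: eqP j => // _ [].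
    split; first exact: vunit_lattice.
    by rewrite /vunit scalerA vtxM eqxx.
  have ew := jD _ j.
  have [xU _ _] := xB e ew; split; first by apply: Lg; apply: (xU j).1.
  by rewrite scalerA vtx_ghost ew eqxx.
- move=> c; rewrite combE => -[z [Iz h]].
  have Lx e : lattice t (comb scal (fun j => c (jE e j)) (x e)).
    have [ew|ew] := eqVneq (tgt e) w; last by rewrite xD //; apply/eqP.
    have [xU _ _] := xB e ew.
    by apply: (kspace_comb (conj k0 kD)) => j; apply: (xU j).1.
  have [||c1 c2] := @gpoly_row_unique _ _ _ emits _ t
    (fun i => \sum_(j < (t i == w)) c (jV i j))
    (fun e => comb scal (fun j => c (jE e j)) (x e)
              - (if tgt e == w then z e else 0)).
  - move=> e; apply: (kspaceB (let: And3 k _ _ := @ghost_row_closed _ _ _ _ in k)).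
      exact: (Lx e).1.
    by case: eqP => _; [apply: (IL (Iz e)).1|exists 0%N; apply: kspace0 (gpoly_row_kspace 0)].
  - under [X in _ + X]eq_bigr do rewrite scalerBr.
    rewrite sumrB addrA h big_mkcond -sumrB big1 // => e _.
    by case: eqP => _; rewrite ?scaler0 subrr.
  case=> [[i j]|[e j]].
    rewrite -(c1 i) (bigD1 j) //= big1 ?addr0 // => k /eqP kj; case: kj.
    by apply: val_inj; case: (t i == w) j k => -[[|]//] ? [[|]].
  have ew := jD _ j.
  have [xU xI _] := xB e ew.
  apply: (xI (fun j => c (jE e j))).
  have := c2 e; rewrite ew eqxx scalerBr => /subr0_eq.
  rewrite (_ : vtx (src e) *: comb _ _ _ = comb scal (fun j => c (jE e j)) (x e)).
    by move=> ->; case: gI => _ + _; apply.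
  rewrite scaler_sumr; apply: eq_bigr => k _; by rewrite -scalZC (xU k).2.
move=> u [[[k gu] du] wu].
have [c0 [y [yP uE]]] := gpoly_row_rec (gpoly_row_le (leqnSn k) gu) du.
have hy e : exists c, tgt e = w -> I (vtx (src e) *: y e - comb scal c (x e)).
  have [ew|ew] := eqVneq (tgt e) w; last by exists (fun=> 0) => /eqP; rewrite (negPf ew).
  have [_ _ xS] := xB e ew.
  have [|c cP] := xS (vtx (src e) *: y e); last by exists c.
  split; last by rewrite scalerA vtxM eqxx.
  by apply: Lv; split; [exists k; apply: (yP e).1|apply: (yP e).2].
have c_ e := cid (hy e); pose c e := sval (c_ e).
have cP e : tgt e = w -> I (vtx (src e) *: y e - comb scal (c e) (x e)).
  exact: svalP (c_ e).
exists (fun j : J => match j with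
  | inl p => c0 (tag p) | inr p => c (tag p) (tagged p) end).
rewrite combE; exists (fun e => if tgt e == w then
  vtx (src e) *: y e - comb scal (c e) (x e) else 0); split=> [e|].
  by case: eqP => [|_]; [apply: cP|apply: kspace0 kI].
rewrite -wu uE scalerDr opprD addrACA -[RHS]add0r; congr (_ + _).
  apply/eqP; rewrite subr_eq0; apply/eqP; rewrite scaler_sumr; apply: eq_bigr => i _.
  rewrite /jV /= -scalZC /vunit [vtx w *: _]scalerA vtxM eq_sym.
  case: eqP => [<-|_]; first by rewrite big_ord1.
  by rewrite big_ord0 rmorph0 scale0r scale0r scaler0.
rewrite scaler_sumr -sumrB [RHS]big_mkcond; apply: eq_bigr => e _.
rewrite scalerA vtx_ghost eq_sym; case: eqP => ew; last first.
  by rewrite scale0r xD // scaler0 subrr.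
by rewrite scalerBr scalerA ghost_vtx eqxx.
Qed.

(** Both sides are the dimension of the part of the lattice at [w] modulo
   [ghost_image I w], computed directly and through the part of [I] at [w]. *)
Lemma index_of_sublattice :
  (forall i, exists m, after_ghosts I m (vunit K E t i)) ->
  exists d h : V -> nat, forall w,
    has_codim scal (vpart w I) (ghost_image I w) (h w) /\
    (vcount t w + \sum_(e : edge E | tgt e == w) d (src e) = d w + h w)%N.
Proof.
move=> ev.
have fL : fin_spanned scal I (lattice t).
  have fi i := let: ex_intro m hm := ev i in fin_spanned_after gI hm.
  apply: fin_spanned_sub (fin_spanned_sum kI fi) => x [[k gx] dx].
  exists (fun i => x 0 i *: vunit K E t i); split; last exact: vdiag_expand.
  by move=> i; exists (x 0 i); split=> //; exists k.
have fv v : fin_spanned scal I (vpart v (lattice t)).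
  by apply: fin_spanned_sub fL => x [].
have [d dP] := choice (fun v => has_codim_exists kI (fv v)).
have hP w : exists h, has_codim scal (vpart w I) (ghost_image I w) h /\
    (vcount t w + \sum_(e : edge E | tgt e == w) d (src e) = d w + h)%N.
  have hw := lattice_codim w dP.
  have IvL x : vpart w I x -> vpart w (lattice t) x.
    by move=> [Ix vx]; split=> //; apply: IL.
  have [J [y [_ [_ _ yS]]]] := hw.
  have [h hh] : exists h, has_codim scal (vpart w I) (ghost_image I w) h.
    apply: has_codim_exists; first exact: ghost_image_kspace.
    by exists J, y => u /IvL/yS.
  have dw : has_codim scal (vpart w (lattice t)) (vpart w I) (d w).
    have [J' [y' [Jd [yU yI yS']]]] := dP w; exists J', y'; split=> //; split=> //.
      by move=> c [/yI].
    move=> u uU; have [c cI] := yS' _ uU; exists c; split=> //.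
    rewrite scalerBr uU.2; congr (_ - _); rewrite scaler_sumr.
    by apply: eq_bigr => j _; rewrite -scalZC (yU j).2.
  exists h; split=> //; apply: has_codim_uniq hw _; first exact: ghost_image_kspace.
  apply: has_codim_tower dw hh => //; first exact: vpart_kspace.
  exact: ghost_image_sub.
by have [h hE] := choice hP; exists d, h.
Qed.

End OneLattice.

(** [I] and its image under [X] are isomorphic finite-codimensional parts of
   the two lattices, so that the equations of [index_of_sublattice] for them
   have the same [h]. *)
Theorem vcount_index (n m : nat) (t : 'I_n -> V) (t' : 'I_m -> V)
    (X : 'M[L]_(n, m)) (Y : 'M[L]_(m, n)) :
  X *m Y = vdiag t -> Y *m X = vdiag t' -> X *m vdiag t' = X -> Y *m vdiag t = Y ->
  exists d : V -> int, forall w, (vcount t w)%:Z - (vcount t' w)%:Z =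
    d w - \sum_(e : edge E | tgt e == w) d (src e).
Proof.
move=> XY YX Xt Yt.
pose I1 x := lattice t x /\ lattice t' (x *m X).
pose I2 y := lattice t' y /\ lattice t (y *m Y).
have closed a b (r : 'I_a -> V) (r' : 'I_b -> V) (Z : 'M[L]_(a, b)) :
    ghost_closed (fun x => lattice r x /\ lattice r' (x *m Z)).
  have [[k0 kD] Lv Lg] := @lattice_closed K V E _ r.
  have [[k0' kD'] Lv' Lg'] := @lattice_closed K V E _ r'.
  split=> [|v x [h h']|e x [h h']].
  - split=> [|c x y [h1 h1'] [h2 h2']]; first by rewrite mul0mx.
    by split; [apply: kD|rewrite mulmxDl -scalemxAl; apply: kD'].
  - by split; [apply: Lv|rewrite -scalemxAl; apply: Lv'].
  - by split; [apply: Lg|rewrite -scalemxAl; apply: Lg'].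
have ev a b (r : 'I_a -> V) (r' : 'I_b -> V) (Z : 'M[L]_(a, b)) :
    Z *m vdiag r' = Z -> forall i, exists k,
    after_ghosts (fun x => lattice r x /\ lattice r' (x *m Z)) k (vunit K E r i).
  move=> Zr i; have [|k hk] := @lattice_eventually K V E _ r' (vunit K E r i *m Z).
    by rewrite -mulmxA Zr.
  exists k; have := @vunit_lattice K V E _ r i.
  elim: k (vunit K E r i) hk => [|k IHk] x /= hx Lx //.
  move=> e; apply: IHk; first by rewrite -scalemxAl; apply: hx.
  by have [_ _ Lg] := @lattice_closed K V E _ r; apply: Lg.
have [d1 [h1 dh1]] := @index_of_sublattice n t I1 (closed _ _ _ _ _)
  (fun x h => h.1) (ev _ _ _ _ _ Xt).
have [d2 [h2 dh2]] := @index_of_sublattice m t' I2 (closed _ _ _ _ _)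
  (fun x h => h.1) (ev _ _ _ _ _ Yt).
have I12 x : I1 x -> I2 (x *m X).
  by move=> [Lx Lx']; split=> //; rewrite -mulmxA XY Lx.2.
have I21 y : I2 y -> I1 (y *m Y).
  by move=> [Ly Ly']; split=> //; rewrite -mulmxA YX Ly.2.
have h12 w : h1 w = h2 w.
  apply: has_codim_uniq (dh2 w).1; first exact/ghost_image_kspace/closed.
  apply: (has_codim_im (f := mulmxr X)) (dh1 w).1.
  - by move=> c x y; rewrite /= mulmxDl -scalemxAl.
  - exact/vpart_kspace/closed.
  - by move=> x [Ix wx]; split; [apply: I12|rewrite /= scalemxAl wx].
  - move=> y [Iy wy]; exists (y *m Y); last by rewrite /= -mulmxA YX Iy.1.2.
    by split; [apply: I21|rewrite scalemxAl wy].
  - move=> x [Ix wx]; split=> [[z [Iz ->]]|[z [Iz /= xE]]].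
      exists (fun e => z e *m X); split=> [e|]; first exact: I12.
      by rewrite /= mulmx_suml; apply: eq_bigr => e _; rewrite scalemxAl.
    exists (fun e => z e *m Y); split=> [e|]; first exact: I21.
    rewrite -[x]Ix.1.2 -XY mulmxA xE mulmx_suml.
    by apply: eq_bigr => e _; rewrite scalemxAl.
exists (fun v => (d1 v)%:Z - (d2 v)%:Z) => w; rewrite sumrB.
have sumZ (d : V -> nat) : \sum_(e : edge E | tgt e == w) (d (src e))%:Z =
    (\sum_(e : edge E | tgt e == w) d (src e))%N%:Z.
  by rewrite (big_morph Posz PoszD (erefl _)).
rewrite !sumZ.
have := congr1 Posz (dh1 w).2; have := congr1 Posz (dh2 w).2; rewrite h12 !PoszD.
by lia.
Qed.

End LatticeIndex.

(** * The Grothendieck group *)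

Section K0Presentation.
Variables (K : fieldType) (V : finType) (E : digraph V).
Hypothesis emits : forall v, exists e : edge E, src e = v.

Local Notation L := (LPA K E).
Local Notation vtx_Vcl := (vtx_Vcl K E).

Section Grothendieck.
Variable M : nmodType.

Definition groth_of (x : M) : groth M := groth_cl (x, 0).

Lemma groth_ofD x y : groth_of (x + y) = groth_of x + groth_of y.
Proof. by rewrite [RHS]groth_addE; congr groth_cl; congr (_, _); rewrite /= addr0. Qed.

Lemma groth_of0 : groth_of 0 = 0.
Proof. by []. Qed.

Lemma groth_clB x y : groth_cl (x, y) = groth_of x - groth_of y.
Proof.
rewrite -[- groth_of y]/(groth_opp (groth_cl (y, 0))) groth_oppE [RHS]groth_addE.
by congr groth_cl; congr (_, _); rewrite /= ?addr0 ?add0r.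
Qed.

Lemma groth_of_eq x y : groth_of x = groth_of y -> exists k, x + k = y + k.
Proof. by move=> /groth_clP[k /=]; rewrite !addr0 => h; exists k. Qed.

Lemma groth_ofMn x n : groth_of (x *+ n) = groth_of x *+ n.
Proof. by elim: n => // n IHn; rewrite !mulrS groth_ofD IHn. Qed.

Lemma groth_of_sum (I : finType) (F : I -> M) : groth_of (\sum_i F i) = \sum_i groth_of (F i).
Proof. exact: (big_morph groth_of groth_ofD groth_of0). Qed.

End Grothendieck.

Definition vclass (v : V) : K0 L := groth_of (vtx_Vcl v).

Definition vclass_comb (z : V -> int) : K0 L := \sum_v vclass v *~ z v.

Lemma vclass_combB z z' : vclass_comb (fun v => z v - z' v) = vclass_comb z - vclass_comb z'.
Proof. by rewrite -sumrB; apply: eq_bigr => v _; rewrite mulrzBr. Qed.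

Lemma Vcl_videm_count n (t : 'I_n -> V) :
  Vcl (videm K E t) = \sum_v vtx_Vcl v *+ vcount t v.
Proof.
rewrite Vcl_videm (partition_big t predT) //=; apply: eq_bigr => v _.
by rewrite (eq_bigr (fun=> vtx_Vcl v)) ?sumr_const // => i /eqP ->.
Qed.

Lemma groth_of_count (a : V -> nat) :
  groth_of (\sum_v vtx_Vcl v *+ a v) = vclass_comb (fun v => (a v)%:Z).
Proof. by rewrite groth_of_sum; apply: eq_bigr => v _; rewrite groth_ofMn. Qed.

Lemma vcount_realize (a : V -> nat) :
  exists n (t : 'I_n -> V), forall v, vcount t v = a v.
Proof.
pose J : finType := {v : V & 'I_(a v)}.
exists #|J|, (fun i => tag (enum_val i)) => v.
rewrite /vcount -sum1_card.
transitivity (\sum_(u : J | tag u == v) 1)%N.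
  by rewrite [RHS](reindex _ (onW_bij _ (@enum_val_bij J))).
transitivity (\sum_(w | w == v) \sum_(j : 'I_(a w)) 1)%N.
  by rewrite sig_big_dep; apply: eq_bigl => u; rewrite andbT.
by rewrite big_pred1_eq sum_nat_const card_ord muln1.
Qed.

Lemma vclass_generate (x : K0 L) : exists z, x = vclass_comb z.
Proof.
have gen e : exists z, groth_of (Vcl e) = vclass_comb z.
  case: e => N eps epsK; have [m [n [s [t h]]]] := vertex_resolution emits epsK.
  exists (fun v => (vcount t v)%:Z - (vcount s v)%:Z).
  by rewrite vclass_combB -!groth_of_count -!Vcl_videm_count -h groth_ofD addrK.
elim/groth_ind: x => p q; rewrite groth_clB.
elim/Vmon_ind: p => e; elim/Vmon_ind: q => f.
have [z ->] := gen e; have [z' ->] := gen f.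
by exists (fun v => z v - z' v); rewrite vclass_combB.
Qed.

Lemma vclass_relation (v : V) : vclass v = \sum_(e : edge E | src e == v) vclass (tgt e).
Proof.
have [e0 <-] := emits v; rewrite /vclass vtx_Vcl_CK2.
by rewrite (big_morph (@groth_of _) (@groth_ofD _) (groth_of0 _)).
Qed.

(** An equality of classes becomes an isomorphism after adding some projective
   module; by [vertex_resolution] this module can be enlarged to a sum of
   modules [L v], and [vcount_index] applies to the isomorphism. *)
Theorem vclass_comb_eq0 (z : V -> int) : vclass_comb z = 0 <->
  exists d : V -> int, forall w,
    z w = d w - \sum_(e : edge E | tgt e == w) d (src e).
Proof.
split=> [z0|[d dP]]; last first.
  have -> : z = fun w => d w - \sum_(e : edge E | tgt e == w) d (src e).
    exact: funext.
  rewrite vclass_combB; apply/eqP; rewrite subr_eq0; apply/eqP/esym.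
  transitivity (\sum_(e : edge E) vclass (tgt e) *~ d (src e)).
    rewrite [RHS](partition_big (@tgt _ E) predT) //=; apply: eq_bigr => w _.
    by rewrite mulrz_sumr; apply: eq_bigr => e /eqP ->.
  rewrite (partition_big (@src _ E) predT) //=; apply: eq_bigr => v _.
  by rewrite [in RHS]vclass_relation mulrz_suml; apply: eq_bigr => e /eqP ->.
pose a v : nat := if (0 <= z v)%R then `|z v|%N else 0%N.
pose b v : nat := if (0 <= z v)%R then 0%N else `|z v|%N.
have zab v : z v = (a v)%:Z - (b v)%:Z by rewrite /a /b; case: ifP; lia.
have /groth_of_eq[k] : groth_of (\sum_v vtx_Vcl v *+ a v) = groth_of (\sum_v vtx_Vcl v *+ b v).
  apply/eqP; rewrite -subr_eq0 !groth_of_count -vclass_combB -[X in _ == X]z0.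
  by apply/eqP; congr vclass_comb; apply: funext.
elim/Vmon_ind: k => -[N eps epsK] h.
have [m [n [s [t st]]]] := vertex_resolution emits epsK.
have [n1 [t1 t1P]] := vcount_realize (fun v => (a v + vcount t v)%N).
have [n2 [t2 t2P]] := vcount_realize (fun v => (b v + vcount t v)%N).
have t12 : Vcl (videm K E t1) = Vcl (videm K E t2).
  have E1 c n' (t' : 'I_n' -> V) : (forall v, vcount t' v = c v + vcount t v)%N ->
      Vcl (videm K E t') = \sum_v vtx_Vcl v *+ c v + Vcl (videm K E t).
    move=> t'P; rewrite !Vcl_videm_count -big_split; apply: eq_bigr => v _.
    by rewrite t'P mulrnDr.
  by rewrite (E1 a _ _ t1P) (E1 b _ _ t2P) -st !addrA h.
have [X [Y [XY YX Xt Yt]]] := Vcl_eqE t12.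
have [d dP] := vcount_index emits XY YX Xt Yt.
exists d => w; rewrite -dP t1P t2P zab; lia.
Qed.

End K0Presentation.

(** * Cokernels of integer matrices *)

Section Cokernel.
Variables (G : zmodType) (n : nat) (g : 'I_n -> G) (M : 'M[int]_n).

Definition int_comb (z : 'rV[int]_n) : G := \sum_i g i *~ z 0 i.

Hypothesis generates : forall x, exists z, x = int_comb z.
Hypothesis relations : forall z, int_comb z = 0 <-> exists d, z = d *m M.

Lemma int_combB z z' : int_comb (z - z') = int_comb z - int_comb z'.
Proof. by rewrite -sumrB; apply: eq_bigr => i _; rewrite !mxE mulrzBr. Qed.

Lemma int_comb_eq z z' : int_comb z = int_comb z' <-> exists d, z - z' = d *m M.
Proof.
rewrite -relations int_combB; split=> [->|]; first by rewrite subrr.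
exact: subr0_eq.
Qed.

Lemma absz_det_unit m (A : 'M[int]_m) : A \in unitmx -> `|\det A|%N = 1%N.
Proof.
move=> /mulmxV/(congr1 (fun B => `|\det B|%N)); rewrite det_mulmx det1 abszM.
by move=> /eqP; rewrite muln_eq1 => /andP[/eqP].
Qed.

Section Smith.
Variables (Lm Rm : 'M[int]_n) (D : 'I_n -> int).
Hypotheses (Lu : Lm \in unitmx) (Ru : Rm \in unitmx) (ME : M = Lm *m diag_mx (\row_i D i) *m Rm).

Lemma absz_det_Smith : `|\det M|%N = (\prod_i `|D i|)%N.
Proof.
rewrite ME !det_mulmx det_diag !abszM !absz_det_unit // mul1n muln1.
rewrite (big_morph absz abszM (erefl _)).
by apply: eq_bigr => i _; rewrite mxE.
Qed.

Let psi (y : 'rV[int]_n) := int_comb (y *m Rm).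

(** In the coordinates of the Smith form the relations are those of the product
   of the groups [Z / D_i]. *)
Lemma psi_eq y y' : psi y = psi y' <-> forall i, (D i %| y ord0 i - y' ord0 i)%Z.
Proof.
rewrite /psi int_comb_eq -mulmxBl; split=> [[d dE] i|h].
  have := congr1 (mulmx^~ (invmx Rm)) dE; rewrite ME !mulmxA !mulmxK //.
  move=> /(congr1 (fun z : 'rV_n => z 0 i)); rewrite mul_mx_diag !mxE => ->.
  exact: dvdz_mull.
have [q qP] := choice (fun i => elimT dvdzP (h i)).
exists (\row_i q i *m invmx Lm); rewrite ME !mulmxA mulmxKV //; congr (_ *m _).
by apply/rowP => i; rewrite mul_mx_diag !mxE qP.
Qed.

Lemma psi_surj x : exists y, x = psi y.
Proof.
have [z ->] := generates x; exists (z *m invmx Rm).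
by rewrite /psi mulmxKV.
Qed.

Lemma card_Smith : (forall i, D i != 0) ->
  ([set: G] #= `I_(\prod_i `|D i|))%card.
Proof.
move=> D0; pose T : finType := {dffun forall i : 'I_n, 'I_`|D i|}.
have Tcard : #|T| = (\prod_i `|D i|)%N.
  rewrite card_dep_ffun foldrE big_map big_enum /=.
  by apply: eq_bigr => i _; rewrite card_ord.
pose f (u : T) : G := psi (\row_i (u i)%:Z).
have f_inj : injective f.
  move=> u u' /psi_eq h; apply/ffunP => i; apply: val_inj => /=.
  have := h i; rewrite !mxE dvdzE => /dvdn_leq.
  have := ltn_ord (u i); have := ltn_ord (u' i).
  move: (nat_of_ord (u i)) (nat_of_ord (u' i)) => a b; lia.
have f_surj x : exists u, x = f u.
  have [y ->] := psi_surj x.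
  have yD i : (`|(y ord0 i %% D i)%Z| < `|D i|)%N.
    by have := ltz_mod (y 0 i) (D0 i); have := modz_ge0 (y 0 i) (D0 i); lia.
  exists [ffun i => Ordinal (yD i)]; apply/psi_eq => i.
  rewrite !mxE ffunE /= gez0_abs ?modz_ge0 // -eqz_mod_dvd.
  by rewrite modz_mod.
rewrite -Tcard; pose h (k : 'I_#|T|) := f (enum_val k).
have h_inj : injective h by move=> k k' /f_inj/enum_val_inj.
have <- : (h @` [set: 'I_#|T|])%classic = [set: G]%classic.
  rewrite eqEsubset; split=> // x _; have [u ->] := f_surj x.
  by exists (enum_rank u) => //; rewrite /h enum_rankK.
apply: card_eq_trans (inj_card_eq (in2W h_inj)) _.
by rewrite card_eq_sym card_II.
Qed.

(** A vanishing [D_i] leaves a copy of [Z]. *)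
Lemma infinite_Smith i : D i = 0 -> infinite_set [set: G]%classic.
Proof.
move=> D0; pose f (k : nat) : G := psi (\row_j (if j == i then k%:Z else 0)).
have f_inj : injective f.
  move=> k k' /psi_eq/(_ i); rewrite D0 !mxE eqxx dvd0z subr_eq0 => /eqP[] //.
apply/infiniteP; apply: (@card_le_trans _ _ _ (f @` [set: nat])%classic).
  by rewrite (card_le_eqr (inj_card_eq (in2W f_inj))).
exact: subset_card_le.
Qed.

End Smith.

Theorem cokernel_card :
  ((0 < `|\det M|)%N -> ([set: G] #= `I_(`|\det M|%N))%card) /\
  (`|\det M|%N = 0%N -> infinite_set [set: G]%classic).
Proof.
have [Lm Lu [Rm Ru [s _ ME]]] := int_Smith_normal_form M.
pose D (i : 'I_n) := s`_i.
have {}ME : M = Lm *m diag_mx (\row_i D i) *m Rm.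
  rewrite {1}ME; congr (_ *m _ *m _).
  by apply/matrixP => i j; rewrite !mxE.
rewrite (absz_det_Smith Lu Ru ME); split=> [h|/eqP h].
  apply: (card_Smith Lu Ru ME) => i; rewrite -absz_gt0.
  by move: h; rewrite (bigD1 i) //= muln_gt0 => /andP[].
have [i /eqP] : exists i, `|D i|%N == 0%N.
  apply/existsP; apply: contraTT h; rewrite negb_exists => /forallP h.
  by rewrite -lt0n prodn_gt0 // => i; rewrite lt0n.
by move/eqP; rewrite absz_eq0 => /eqP; apply: (infinite_Smith Lu Ru ME).
Qed.

End Cokernel.

(** * Finite graphs without sinks *)

Lemma row_incidence (n : nat) (E : digraph 'I_n) (d : 'I_n -> int) w :
  (\row_v d v *m incidence E) 0 w = \sum_(e : edge E | tgt e == w) d (src e).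
Proof.
rewrite mxE (partition_big (@src _ E) predT) //=; apply: eq_bigr => v _.
rewrite !mxE (eq_bigr (fun=> d v)) => [|e /andP[_ /eqP->] //].
rewrite sumr_const -mulr_natr natz; congr (_ * (Posz _)).
by apply: eq_card => e; rewrite !inE andbC.
Qed.

(** [K_0] is the cokernel of [1 - A], where [A] is the incidence matrix, and a
   matrix has the same determinant as its transpose. *)
Theorem K0_card (K : fieldType) (n : nat) (E : digraph 'I_n) :
  (forall v, exists e : edge E, src e = v) ->
  let H := `|\det (1%:M - (incidence E)^T)|%N in
  ((0 < H)%N -> ([set: K0 (LPA K E)] #= `I_H)%card) /\
  (H = 0%N -> infinite_set [set: K0 (LPA K E)]%classic).
Proof.
move=> emits H.
have -> : H = `|\det (1%:M - incidence E)|%N.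
  by rewrite /H -[in RHS]det_tr linearB /= trmx1.
apply: (@cokernel_card _ _ (fun v => vclass K E v)) => [x|z].
  have [z ->] := @vclass_generate K _ E emits x; exists (\row_v z v).
  by apply: eq_bigr => v _; rewrite mxE.
rewrite [int_comb _ _]/(vclass_comb K E (fun v => z 0 v)) (@vclass_comb_eq0 K _ E emits).
split=> [[d dP]|[d dP]].
  exists (\row_v d v); rewrite mulmxBr mulmx1; apply/rowP => w.
  by rewrite dP -row_incidence !mxE.
exists (fun v => d 0 v) => w; rewrite dP mulmxBr mulmx1 -row_incidence.
by rewrite [LHS]mxE [X in _ + X]mxE; congr (_ - (_ *m _) _ _); apply/rowP => i; rewrite mxE.
Qed.

Local Open Scope classical_set_scope.
Local Open Scope card_scope.

Theorem proposition2p3 (K : fieldType) (n j : nat)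
    (hn : (0 < n)%N) (hj : (0 <= j <= n - 1)%N) :
  ((0 < haselgrove j n)%N ->
     [set: K0 (LPA K (Cgraph n j))] #= `I_(haselgrove j n)) /\
  (haselgrove j n = 0%N ->
     infinite_set [set: K0 (LPA K (Cgraph n j))]).
Proof.
by apply: (@K0_card K n (Cgraph n j)) => v; exists (inl v).
Qed.
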